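(* Let $n = 2^{d+s+t} + 2^{d+s} + 2^d - 3$ with $d, s, t$ non-negative integers. If $d \geqslant 6$ and $s, t \geqslant 4$, then $$\dim \mathrm{Ker}\big((\widetilde{Sq}^0_* )_{(5,n)}\big) = (2^3-1)(2^4-1)(2^5-1) = 3255.$$
   Context: $P_k = \mathbb F_2[x_1,\dots,x_k]$ is the graded polynomial algebra with each $x_i$ of degree 1, a module over the mod-2 Steenrod algebra $\mathcal A$ (action of the Steenrod squares $Sq^i$ determined by the usual axioms and the Cartan formula). $\mathcal A^+$ is the augmentation ideal of $\mathcal A$, and $QP_k = P_k/\mathcal A^+P_k = \mathbb F_2\otimes_{\mathcal A}P_k$; $(QP_k)_n$ is its degree-$n$ part. Kameko's squaring operation: let $\varphi: P_k\to P_k$ be the $\mathbb F_2$-linear map with $\varphi(x) = y$ if the monomial $x$ equals $x_1x_2\cdots x_k y^2$, and $\varphi(x)=0$ otherwise. For $n$ with $n-k$ even, $\varphi$ induces a homomorphism $(\widetilde{Sq}^0_* )_{(k,n)}: (QP_k)_n \to (QP_k)_{(n-k)/2}$. *)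

(* Defs.v *)
From HB Require Import structures.
From mathcomp Require Import all_boot all_algebra.
Set Implicit Arguments. Unset Strict Implicit. Unset Printing Implicit Defensive.
Import GRing.Theory.
Local Open Scope ring_scope.

Definition mon (k d : nat) : finType :=
  {a : {ffun 'I_k -> 'I_d.+1} | (\sum_(j < k) (a j : nat))%N == d}.

Definition expo (k d : nat) (a : mon k d) (j : 'I_k) : nat := val a j.

(* (P_k)_d : the degree-d homogeneous part of F_2[x_1,...,x_k],
   as the F_2-vector space of functions monomials -> F_2. *)
Definition HP (k d : nat) := {ffun mon k d -> ('F_2)^o}.

(* Coefficient of x^b in Sq^i(x^a), where deg b - deg a = i:
   by Sq(x_j) = x_j + x_j^2 and the Cartan formula,
   Sq^i(x^a) = sum_{b >= a, |b| = |a|+i} prod_j C(a_j, b_j - a_j) x^b. *)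
Definition sq_coef (k e d : nat) (a : mon k e) (b : mon k d) : ('F_2)^o :=
  (([forall j, expo a j <= expo b j] : nat) *
   \prod_(j < k) 'C(expo a j, expo b j - expo a j))%N%:R.

Definition sq (k e d : nat) (f : HP k e) : HP k d :=
  [ffun b => \sum_(a : mon k e) f a * sq_coef a b].

Definition hit (k d : nat) : {vspace HP k d} :=
  (\sum_(e < d) limg (linfun (@sq k e d)))%VS.

(* Kameko's map phi : (P_k)_n -> (P_k)_m, phi(x_1...x_k y^2) = y, else 0. *)
Definition kameko (k n m : nat) (f : HP k n) : HP k m :=
  [ffun b => \sum_(a : mon k n | [forall j, expo a j == (2 * expo b j).+1]) f a].

(* Preimage under phi of the hit subspace (A^+P_k)_m; the kernel of the
   induced map (QP_k)_n -> (QP_k)_m is kameko_preim / hit k n. *)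
Definition kameko_preim (k n m : nat) : {vspace HP k n} :=
  (linfun (@kameko k n m) @^-1: hit k m)%VS.

(* Main.v *)
Require Import Defs.
From HB Require Import structures.
From Stdlib Require Import BinNat.
From mathcomp Require Import all_boot all_algebra zify.
From mathcomp.multinomials Require Import mpoly.
Set Implicit Arguments. Unset Strict Implicit. Unset Printing Implicit Defensive.
Import GRing.Theory.
Local Open Scope ring_scope.

(* Dually to (QP_k)_n, consider the functionals on (P_k)_n that kill the hit polynomials. The total
   square Sq = sum_i Sq^i is the ring endomorphism x |-> x + x^2, and a functional kills the hit
   polynomials of degree n iff its extension by zero to all of P_k is invariant under Sq. The kernel
   of Kameko's map is dual to these functionals, restricted to the monomials in which some exponent
   is even.

   Write a monomial by rows as X_{I_1} X_{I_2}^2 X_{I_3}^4 ..., where X_I is the product of the x_i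
   with i in I. In the degrees considered here a functional K killing hits vanishes when I_1 has one
   element, so that g |-> K (X_I g^2) again kills hits when #|I| = 3. Applying Sq^1 to X_I g^2 with
   #|I| = 4, and Sq^2 once, gives exchange relations between neighbouring rows: the Pluecker
   relations of the Grassmannian Gr(3,5), together with cubic relations. In degree 5 these relations
   generate all relations that hold on the 155 points of Gr(3,5) over F_2. Thus K restricted to the
   monomials that start with five rows of size 3 is a combination of the products of Pluecker
   coordinates of the points W, with coefficients K_W that are functionals of the remaining rows;
   Sq^1 shows that K_W lives on the subspace W, and it also reduces rows of size 5 to rows of size 3.
   The same argument for the rows of size 2 (planes in W) and then of size 1 (lines in the plane)
   gives a basis of these functionals indexed by the flags of dimensions 1, 2, 3 in F_2^5, of which
   there are 155 * 7 * 3 = 3255. *)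

Local Notation P k := {mpoly 'F_2[k]}.

(** * The total Steenrod square and Kameko's map on polynomials *)

Lemma F2_cases (c : 'F_2) : c = 0 \/ c = 1.
Proof. by case: c => -[|[|//]] hc; [left|right]; apply: val_inj. Qed.

Lemma F2_addxx (c : 'F_2) : c + c = 0.
Proof. by case: (F2_cases c) => ->; apply: val_inj. Qed.

Lemma F2_add_eq0 (x y : 'F_2) : x + y = 0 -> x = y.
Proof. by move=> e; rewrite -[x]addr0 -(F2_addxx y) addrA e add0r. Qed.

Lemma F2_natr (n : nat) : n%:R = (odd n)%:R :> 'F_2.
Proof.
rewrite -[n in LHS]odd_double_half natrD -muln2 natrM.
by rewrite [2%:R]F2_addxx mulr0 addr0.
Qed.

Section CharTwo.
Variable k : nat.
Implicit Types f g : P k.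

Lemma mp_addxx f : f + f = 0.
Proof. by apply/mpolyP => m; rewrite mcoeffD mcoeff0 F2_addxx. Qed.

Lemma mp_sqrD f g : (f + g) ^+ 2 = f ^+ 2 + g ^+ 2.
Proof. by rewrite sqrrD mulr2n mp_addxx addr0. Qed.

Lemma mp_sqr_sum (I : Type) (r : seq I) (p : pred I) (F : I -> P k) :
  (\sum_(i <- r | p i) F i) ^+ 2 = \sum_(i <- r | p i) F i ^+ 2.
Proof.
elim/big_rec2: _ => [|i x y _ <-]; first by rewrite expr0n.
by rewrite mp_sqrD.
Qed.

Lemma mp_add_ind (Q : P k -> Prop) :
  Q 0 -> (forall m, Q 'X_[m]) -> (forall f g, Q f -> Q g -> Q (f + g)) ->
  forall f, Q f.
Proof.
move=> Q0 QX QD; elim/mpolyind => // c m p _ nz_c Qp.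
apply: QD => //; case: (F2_cases c) nz_c => ->; first by rewrite eqxx.
by rewrite scale1r.
Qed.

Lemma mp_alg_ind (Q : P k -> Prop) :
  Q 0 -> Q 1 -> (forall i, Q 'X_i) -> (forall f g, Q f -> Q g -> Q (f + g)) ->
  (forall f g, Q f -> Q g -> Q (f * g)) -> forall f, Q f.
Proof.
move=> Q0 Q1 QX QD QM; apply: mp_add_ind => // m.
rewrite mpolyXE_id; elim/big_ind: _ => // i _.
by elim: (m i) => [|n IHn]; rewrite ?expr0 // exprS; apply: QM.
Qed.

Definition xprod (J : {set 'I_k}) : P k := \prod_(i in J) 'X_i.

Lemma X_homog i : ('X_i : P k) \is 1.-homog.
Proof. by rewrite dhomogX; apply/eqP/mdeg1. Qed.

Lemma mon_homog m : ('X_[m] : P k) \is (mdeg m).-homog.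
Proof. by rewrite dhomogX. Qed.

Lemma xprod_homog J : xprod J \is #|J|.-homog.
Proof.
rewrite /xprod -sum1_card.
elim/big_rec2: _ => [|i p d _ hp]; first exact: dhomog1.
by apply: dhomogM => //; apply: X_homog.
Qed.

Lemma xprodU1 i (J : {set _}) : i \notin J -> xprod (i |: J) = 'X_i * xprod J.
Proof. by move=> iJ; rewrite /xprod big_setU1. Qed.

Lemma xprodD1 i (J : {set _}) : i \in J -> xprod J = 'X_i * xprod (J :\ i).
Proof. by move=> iJ; rewrite /xprod (big_setD1 i). Qed.

Definition oddset (m : 'X_{1..k}) : {set 'I_k} := [set i | odd (m i)].
Definition halfm (m : 'X_{1..k}) : 'X_{1..k} := [multinom (m i)./2 | i < k].

Lemma mon_split m : 'X_[m] = xprod (oddset m) * 'X_[halfm m] ^+ 2 :> P k.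
Proof.
rewrite !mpolyXE_id /xprod -prodrXl [X in X * _]big_mkcond -big_split /=.
apply: eq_bigr => i _; rewrite inE mnmE -exprM muln2.
rewrite -[m i in LHS]odd_double_half exprD.
by case: odd; rewrite ?expr1 ?expr0.
Qed.

Lemma mp_split_ind (Q : P k -> Prop) :
  Q 0 -> (forall J m, Q (xprod J * 'X_[m] ^+ 2)) ->
  (forall f g, Q f -> Q g -> Q (f + g)) -> forall f, Q f.
Proof. by move=> Q0 QX QD; apply: mp_add_ind => // m; rewrite mon_split. Qed.

End CharTwo.

(** * Substitution homomorphisms and the total square *)

HB.lock Definition sub k l (h : 'I_k -> P l) (f : P k) : P l :=
  f \mPo [tuple h i | i < k].

Arguments sub {k l} h f.

Section Subst.

Variables k l : nat.
Implicit Types h : 'I_k -> P l.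

Lemma subX h i : sub h 'X_i = h i.
Proof. by rewrite unlock comp_mpolyXU -tnth_nth tnth_mktuple. Qed.

Lemma sub0 h : sub h 0 = 0. Proof. by rewrite unlock rmorph0. Qed.
Lemma sub1 h : sub h 1 = 1. Proof. by rewrite unlock rmorph1. Qed.
Lemma subD h : {morph sub h : f g / f + g}.
Proof. by move=> f g; rewrite unlock rmorphD. Qed.
Lemma subM h : {morph sub h : f g / f * g}.
Proof. by move=> f g; rewrite unlock rmorphM. Qed.
Lemma subXn h n : {morph sub h : f / f ^+ n}.
Proof. by move=> f; rewrite unlock rmorphXn. Qed.
Lemma sub_sum h (I : Type) (r : seq I) (c : pred I) F :
  sub h (\sum_(i <- r | c i) F i) = \sum_(i <- r | c i) sub h (F i).
Proof. by rewrite unlock rmorph_sum. Qed.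
Lemma sub_prod h (I : Type) (r : seq I) (c : pred I) F :
  sub h (\prod_(i <- r | c i) F i) = \prod_(i <- r | c i) sub h (F i).
Proof. by rewrite unlock rmorph_prod. Qed.

Lemma sub_mon h m : sub h 'X_[m] = \prod_(i < k) h i ^+ m i.
Proof. by rewrite unlock comp_mpolyX; apply: eq_bigr => i _; rewrite tnth_mktuple. Qed.

Lemma sub_homog h d (f : P k) :
  (forall i, h i \is 1.-homog) -> f \is d.-homog -> sub h f \is d.-homog.
Proof.
move=> hh /dhomogP hf; rewrite [f]mpolyE sub_sum big_seq rpred_sum // => m /hf <-.
case: (F2_cases f@_m) => ->; first by rewrite scale0r sub0 rpred0.
rewrite scale1r sub_mon.
suff: \prod_(i < k) h i ^+ m i \is (\sum_(i < k) m i)%N.-homog by rewrite -mdegE.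
elim/big_rec2: _ => [|i p e _ hp]; first exact: dhomog1.
by apply: dhomogM => //; have := dhomogMn (m i) (hh i); rewrite mul1n.
Qed.

End Subst.

HB.lock Definition Sq k : P k -> P k := sub (fun i => 'X_i + 'X_i ^+ 2).

Arguments Sq {k} f.

Lemma Sq0 k : Sq (0 : P k) = 0. Proof. by rewrite unlock sub0. Qed.
Lemma Sq1 k : Sq (1 : P k) = 1. Proof. by rewrite unlock sub1. Qed.
Lemma SqD k : {morph @Sq k : f g / f + g}.
Proof. by move=> f g; rewrite unlock subD. Qed.
Lemma SqM k : {morph @Sq k : f g / f * g}.
Proof. by move=> f g; rewrite unlock subM. Qed.
Lemma SqXn k n : {morph @Sq k : f / f ^+ n}.
Proof. by move=> f; rewrite unlock subXn. Qed.
Lemma Sq_sum k (I : Type) (r : seq I) (c : pred I) (F : I -> P k) :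
  Sq (\sum_(i <- r | c i) F i) = \sum_(i <- r | c i) Sq (F i).
Proof. by rewrite unlock sub_sum. Qed.
Lemma Sq_prod k (I : Type) (r : seq I) (c : pred I) (F : I -> P k) :
  Sq (\prod_(i <- r | c i) F i) = \prod_(i <- r | c i) Sq (F i).
Proof. by rewrite unlock sub_prod. Qed.

Lemma Sq_mon k (m : 'X_{1..k}) : Sq 'X_[m] = \prod_(i < k) ('X_i + 'X_i ^+ 2) ^+ m i :> P k.
Proof. by rewrite unlock sub_mon. Qed.

Lemma SqX k (i : 'I_k) : Sq 'X_i = 'X_i + 'X_i ^+ 2.
Proof. by rewrite unlock subX. Qed.

Section Sub2.
Variables (k l : nat) (h : 'I_k -> P l).

(** Linear forms satisfy this because squaring is additive over F_2; it is what a substitution must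
    satisfy on the variables in order to commute with [Sq]. *)
Definition linform (p : P l) := Sq p = p + p ^+ 2.

Lemma linform_sum (I : Type) (r : seq I) (c : pred I) (F : I -> 'I_l) :
  linform (\sum_(i <- r | c i) 'X_(F i)).
Proof.
rewrite /linform Sq_sum mp_sqr_sum -big_split.
by apply: eq_bigr => i _; rewrite SqX.
Qed.

Lemma Sq_sub f : (forall i, linform (h i)) -> Sq (sub h f) = sub h (Sq f).
Proof.
move=> lh; move: f; apply: mp_alg_ind => [||i|f g Ff Fg|f g Ff Fg].
- by rewrite sub0 !Sq0 sub0.
- by rewrite sub1 !Sq1 sub1.
- by rewrite SqX subD subXn subX lh.
- by rewrite subD !SqD subD Ff Fg.
- by rewrite subM !SqM subM Ff Fg.
Qed.

End Sub2.

Definition upm k (m : 'X_{1..k}) : 'X_{1..k} := [multinom (m i).*2.+1 | i < k].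

(** The bound [msize f] loses nothing: [upm] does not lower degrees, so a larger [m] has coefficient
    zero at [upm m]. *)
HB.lock Definition phi k (f : P k) : P k :=
  \sum_(m : 'X_{1..k < msize f}) f@_(upm m) *: 'X_[m].

Arguments phi {k} f.

Section Kameko.
Variable k : nat.
Implicit Types (f g : P k) (J : {set 'I_k}) (m : 'X_{1..k}).

Lemma mdeg_upm m : (mdeg m <= mdeg (upm m))%N.
Proof.
rewrite !mdegE; apply: leq_sum => i _; rewrite mnmE -addnn.
by rewrite (leq_trans (leq_addr (m i) (m i))).
Qed.

Lemma mcoeff_phi f m : (phi f)@_m = f@_(upm m).
Proof.
rewrite unlock raddf_sum /=.
case: (ltnP (mdeg m) (msize f)) => hm.
  rewrite (bigD1 (BMultinom hm)) //= mcoeffZ mcoeffX eqxx mulr1 big1 ?addr0 // => i ne.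
  rewrite mcoeffZ mcoeffX; case: eqP => [e|_]; last by rewrite mulr0.
  by case/eqP: ne; apply: val_inj.
rewrite big1 => [|i _].
  by apply/esym/memN_msupp_eq0/msize_mdeg_ge/(leq_trans hm)/mdeg_upm.
rewrite mcoeffZ mcoeffX; case: eqP => [e|_]; last by rewrite mulr0.
by have := bmdeg i; rewrite e ltnNge hm.
Qed.

Lemma phiD : {morph @phi k : f g / f + g}.
Proof. by move=> f g; apply/mpolyP => m; rewrite mcoeffD !mcoeff_phi mcoeffD. Qed.

Lemma phi0 : phi (0 : P k) = 0.
Proof. by apply/mpolyP => m; rewrite mcoeff_phi !mcoeff0. Qed.

Lemma phi_monoid J m : phi (xprod J * 'X_[m] ^+ 2) = if J == setT then 'X_[m] else 0.
Proof.
have -> : xprod J * 'X_[m] ^+ 2 = 'X_[[multinom (i \in J) + (m i).*2 | i < k]].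
  rewrite [RHS]mon_split; congr (xprod _ * 'X_[_] ^+ 2); first apply/setP => i.
    by rewrite inE mnmE oddD odd_double addbF; case: (i \in J).
  by apply/mnmP => i; rewrite !mnmE; case: (i \in J); rewrite ?half_bit_double //= doubleK.
apply/mpolyP => m'; rewrite mcoeff_phi mcoeffX.
case: (eqVneq J setT) => [->|/eqP nJ].
  rewrite mcoeffX; congr (_%:R); congr nat_of_bool; apply/eqP/eqP => [/mnmP e|->].
    by apply/mnmP => i; move: (e i); rewrite !mnmE inE => -[] /double_inj.
  by apply/mnmP => i; rewrite !mnmE inE.
rewrite mcoeff0; case: eqP => // /mnmP e; case: nJ; apply/setP => i; rewrite inE.
by move: (congr1 odd (e i)); rewrite !mnmE oddD /= !odd_double addbF; case: (i \in J).
Qed.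

(** Kameko's map is thus determined by its values on the squarefree monomials [xprod J]. *)
Lemma phi_sqr f g : phi (f * g ^+ 2) = phi f * g.
Proof.
elim/mp_split_ind: f g => [|J m|f1 f2 I1 I2] g.
- by rewrite mul0r phi0 mul0r.
- elim/mp_add_ind: g => [|m'|g1 g2 I1 I2].
  + by rewrite expr0n /= !mulr0 phi0.
  + rewrite -mulrA -exprMn -mpolyXD !phi_monoid.
    by case: ifP => _; rewrite ?mpolyXD ?mul0r.
  + by rewrite mp_sqrD !mulrDr phiD I1 I2.
- by rewrite mulrDl !phiD I1 I2 mulrDl.
Qed.

Lemma phi_xprod J : phi (xprod J) = (J == setT)%:R.
Proof.
have := phi_monoid J 0; rewrite mpolyX0 expr1n mulr1 => ->.
by case: eqP.
Qed.

Lemma prod_add_set J (a b : 'I_k -> P k) :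
  \prod_(i in J) (a i + b i) =
  \sum_(K : {set 'I_k} | K \subset J) (\prod_(i in K) a i) * \prod_(i in J :\: K) b i.
Proof.
transitivity (\prod_i ((if i \in J then a i else 0) + (if i \in J then b i else 1))).
  by rewrite big_mkcond; apply: eq_bigr => i _; case: ifP => _; rewrite ?add0r.
rewrite bigA_distr [RHS]big_mkcond; apply: eq_bigr => K _; case: ifP => [KJ|/negbT/subsetPn].
  rewrite [in RHS]big_mkcond [X in _ * X]big_mkcond -big_split /=.
  apply: eq_bigr => i _; rewrite inE; case: ifP => [iK|_]; rewrite ?mulr1 ?mul1r //.
  by rewrite (subsetP KJ).
by case=> i iK iJ; rewrite (bigD1 i) //= iK (negbTE iJ) mul0r.
Qed.

Lemma prod_add_sqr J (h : 'I_k -> P k) :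
  \prod_(i in J) ('X_i + h i ^+ 2) =
  \sum_(K : {set 'I_k} | K \subset J) xprod K * (\prod_(i in J :\: K) h i) ^+ 2.
Proof.
by rewrite prod_add_set; apply: eq_bigr => K _; rewrite prodrXl.
Qed.

Lemma Sq_xprod J : Sq (xprod J) =
  \sum_(K : {set 'I_k} | K \subset J) xprod K * xprod (J :\: K) ^+ 2.
Proof. by rewrite Sq_prod -prod_add_sqr; apply: eq_bigr => i _; rewrite SqX. Qed.

(** By [phi_sqr] it suffices to treat [xprod J]. In the expansion of [Sq (xprod J)] only the summand
    with the full set survives [phi], and it occurs only if [J] is full. *)
Lemma phi_Sq f : phi (Sq f) = Sq (phi f).
Proof.
elim/mp_split_ind: f => [|J m|f g If Ig]; first by rewrite phi0 !Sq0 phi0.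
  rewrite SqM SqXn !phi_sqr SqM; congr (_ * _).
  rewrite Sq_xprod phi_xprod; case: eqVneq => [->|nJ].
    rewrite Sq1 (bigD1 setT) //= phiD phi_sqr phi_xprod eqxx setDv.
    rewrite /xprod big_set0 mul1r; set s := (X in _ + phi X); suff -> : phi s = 0 by rewrite addr0.
    rewrite {}/s; elim/big_ind: _ => [|x y|K /andP[_ nK]]; first exact: phi0.
      by rewrite phiD => -> ->; rewrite addr0.
    by rewrite phi_sqr phi_xprod (negbTE nK) mul0r.
  rewrite Sq0; elim/big_ind: _ => [|x y|K KJ]; first exact: phi0.
    by rewrite phiD => -> ->; rewrite addr0.
  rewrite phi_sqr phi_xprod; case: eqP => [e|]; last by rewrite mul0r.
  by case/negP: nJ; rewrite eqEsubset subsetT -e.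
by rewrite SqD !phiD SqD If Ig.
Qed.

End Kameko.

(** The expansion of [(x + x^2)^a = x^a (1 + x)^a] in each variable. This links [Sq] with the
    formula in [sq_coef]. *)
Lemma mcoeff_Sq k (m b : 'X_{1..k}) : (Sq 'X_[m] : P k)@_b =
  (([forall i, (m i <= b i)%N] : nat) * \prod_(i < k) 'C(m i, b i - m i))%N%:R.
Proof.
pose N := (mdeg m + mdeg b).+1.
have ltN c i : (mdeg c < N)%N -> (c i < N)%N.
  by apply: leq_ltn_trans; rewrite mdegE (bigD1 i) //= leq_addr.
have lmN i : (m i < N)%N by apply: ltN; rewrite /N; lia.
have lbN i : (b i < N)%N by apply: ltN; rewrite /N; lia.
have -> : Sq 'X_[m] = \sum_(f : {ffun 'I_k -> 'I_N})
    (\prod_i 'C(m i, f i))%:R *: 'X_[[multinom (m i + f i)%N | i < k]].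
  rewrite Sq_mon.
  transitivity (\prod_(i < k) \sum_(j < N) 'C(m i, j)%:R *: ('X_i ^+ (m i + j) : P k)).
    apply: eq_bigr => i _.
    have -> : 'X_i + 'X_i ^+ 2 = 'X_i * (1 + 'X_i) :> P k by rewrite mulrDr mulr1 expr2.
    rewrite exprMn exprDn.
    rewrite (big_ord_widen N (fun j => 1 ^+ (m i - j) * 'X_i ^+ j *+ 'C(m i, j))) ?lmN //.
    rewrite big_mkcond mulr_sumr; apply: eq_bigr => j _; rewrite ltnS; case: leqP => hj.
      by rewrite expr1n mul1r mulrnAr exprD scaler_nat.
    by rewrite bin_small ?scale0r ?mulr0.
  rewrite bigA_distr_bigA; apply: eq_bigr => f _.
  rewrite scaler_prod natr_prod; congr (_ *: _).
  by rewrite mpolyXE_id; apply: eq_bigr => i _; rewrite mnmE.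
rewrite raddf_sum /=.
case: (altP forallP) => [mb|/forallPn [i0 mb]]; last first.
  rewrite big1 // => f _; rewrite mcoeffZ mcoeffX; case: eqP => [e|]; last by rewrite mulr0.
  by case/negP: mb; rewrite -e mnmE leq_addr.
have lf i : (b i - m i < N)%N by rewrite (leq_ltn_trans (leq_subr _ _)).
rewrite (bigD1 [ffun i => Ordinal (lf i)]) //= mcoeffZ mcoeffX.
have -> : [multinom (m i + [ffun i => Ordinal (lf i)] i)%N | i < k] = b.
  by apply/mnmP => i; rewrite mnmE ffunE /= subnKC.
rewrite eqxx mulr1 mul1n [X in _ + X]big1 ?addr0 => [|f ne].
  by congr (_%:R); apply: eq_bigr => i _; rewrite ffunE.
rewrite mcoeffZ mcoeffX; case: eqP => [e|]; last by rewrite mulr0.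
case/eqP: ne; apply/ffunP => i; apply: val_inj; rewrite ffunE /= -e mnmE.
by rewrite addKn.
Qed.

(** * Lowest and highest terms of the total square *)

Section SqSupp.
Variable k : nat.
Implicit Types m b : 'X_{1..k}.

Lemma msupp_Sq m b : b \in msupp (Sq 'X_[m] : P k) ->
  forall i, (m i <= b i <= (m i).*2)%N.
Proof.
rewrite mcoeff_msupp mcoeff_Sq => nz i.
have [h|h] := altP (@forallP _ (fun i => (m i <= b i)%N)); last first.
  by rewrite (negbTE h) mul0n eqxx in nz.
rewrite h; case: leqP => // lt; case/eqP: nz.
rewrite (bigD1 i) //= bin_small ?mul0n ?muln0 //.
by have := h i; move: lt; lia.
Qed.

Lemma msupp_Sq_low m b : b \in msupp (Sq 'X_[m] : P k) -> b != m -> (mdeg m < mdeg b)%N.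
Proof.
move=> /msupp_Sq h ne; rewrite ltn_neqAle; apply/andP; split; last first.
  by rewrite !mdegE; apply: leq_sum => i _; case/andP: (h i).
apply: contra ne; rewrite !mdegE => /eqP e; apply/eqP/mnmP => i.
have /eqP := e; rewrite eq_sym => /eqP {}e.
have le j : (m j <= b j)%N by case/andP: (h j).
move: e; rewrite (bigD1 i) //= [in RHS](bigD1 i) //=.
have : (\sum_(j < k | j != i) m j <= \sum_(j < k | j != i) b j)%N by apply: leq_sum.
by have := le i; do 2!move: (\sum_(_ < k | _) _)%N => ?; lia.
Qed.

Lemma msupp_Sq_top m b :
  b \in msupp (Sq 'X_[m] : P k) -> b != (m + m)%MM -> (mdeg b < mdeg m + mdeg m)%N.
Proof.
move=> /msupp_Sq h ne; rewrite -mdegD ltn_neqAle; apply/andP; split; last first.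
  by rewrite !mdegE; apply: leq_sum => i _; rewrite mnmDE addnn; case/andP: (h i).
apply: contra ne; rewrite !mdegE => /eqP e; apply/eqP/mnmP => i.
have le j : (b j <= (m + m)%MM j)%N by rewrite mnmDE addnn; case/andP: (h j).
move: e; rewrite (bigD1 i) //= [in RHS](bigD1 i) //=.
have : (\sum_(j < k | j != i) b j <= \sum_(j < k | j != i) (m + m)%MM j)%N by apply: leq_sum.
by have := le i; do 2!move: (\sum_(_ < k | _) _)%N => ?; lia.
Qed.

Lemma mcoeff_Sq_low m : (Sq 'X_[m] : P k)@_m = 1.
Proof.
rewrite mcoeff_Sq big1 ?muln1 => [|i _]; last by rewrite subnn bin0.
by have -> : [forall i, (m i <= m i)%N] by apply/forallP.
Qed.

Lemma mcoeff_Sq_top m : (Sq 'X_[m] : P k)@_(m + m) = 1.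
Proof.
rewrite mcoeff_Sq big1 ?muln1 => [|i _]; last by rewrite mnmDE addnK binn.
by have -> : [forall i, (m i <= (m + m)%MM i)%N] by apply/forallP => i; rewrite mnmDE leq_addr.
Qed.

End SqSupp.

(** * Functionals that kill the hit polynomials *)

Record hitfree (k n : nat) (K : P k -> 'F_2) : Prop := HitFree {
  KD : forall f g, K (f + g) = K f + K g;
  KSq : forall f, K (Sq f) = K f;
  Kdeg : forall m, mdeg m != n -> K 'X_[m] = 0 }.

Lemma add_F2_0 (U : zmodType) (K : U -> 'F_2) :
  (forall f g, K (f + g) = K f + K g) -> K 0 = 0.
Proof. by move=> KD; have := KD 0 0; rewrite addr0 F2_addxx. Qed.

Lemma add_F2_sum (U : zmodType) (K : U -> 'F_2) (I : Type) (r : seq I) (c : pred I) F :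
  (forall f g, K (f + g) = K f + K g) ->
  K (\sum_(i <- r | c i) F i) = \sum_(i <- r | c i) K (F i).
Proof.
move=> KD; elim/big_rec2: _ => [|i x y _ <-]; first exact: add_F2_0.
exact: KD.
Qed.

Lemma add_F2_Z k (K : P k -> 'F_2) c f :
  (forall f g, K (f + g) = K f + K g) -> K (c *: f) = c * K f.
Proof.
move=> KD; case: (F2_cases c) => ->; first by rewrite scale0r mul0r; apply: add_F2_0.
by rewrite scale1r mul1r.
Qed.

Section Functionals.
Variables (k n : nat) (K : P k -> 'F_2).
Hypothesis HK : hitfree n K.
Implicit Types (f g : P k) (J I : {set 'I_k}) (m b : 'X_{1..k}).

Lemma K0 : K 0 = 0. Proof. exact: add_F2_0 (KD HK). Qed.

Lemma Ksum (T : Type) (r : seq T) (c : pred T) F :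
  K (\sum_(i <- r | c i) F i) = \sum_(i <- r | c i) K (F i).
Proof. exact: add_F2_sum (KD HK). Qed.

Lemma K_add0 f g : K f = 0 -> K g = 0 -> K (f + g) = 0.
Proof. by rewrite (KD HK) => -> ->; rewrite addr0. Qed.

Lemma KZ c f : K (c *: f) = c * K f.
Proof. exact: add_F2_Z (KD HK). Qed.

Lemma Khomog d f : f \is d.-homog -> d != n -> K f = 0.
Proof.
move=> /dhomogP hf ne; rewrite [f]mpolyE Ksum big_seq big1 // => m /hf e.
by rewrite KZ (Kdeg HK) ?mulr0 // e.
Qed.

Lemma KM_supp c f p b0 : f \is c.-homog ->
  (forall b, b \in msupp p -> b != b0 -> c + mdeg b != n)%N ->
  K (f * p) = p@_b0 * K (f * 'X_[b0]).
Proof.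
move=> hf h; rewrite [p in LHS]mpolyE mulr_sumr Ksum.
under eq_bigr => m _ do rewrite -scalerAr KZ.
have E b : b \in msupp p -> b != b0 -> p@_b * K (f * 'X_[b]) = 0.
  move=> bp ne; rewrite (@Khomog (c + mdeg b)) ?mulr0 ?h //.
  by apply: dhomogM => //; apply: mon_homog.
case: (boolP (b0 \in msupp p)) => b0p.
  by rewrite (bigD1_seq b0) //= big_seq_cond big1 ?addr0 // => b /andP[]; apply: E.
rewrite (memN_msupp_eq0 b0p) mul0r big_seq big1 // => b bp; apply: E => //.
by apply: contraNneq b0p => <-.
Qed.

Lemma KM_Sq_low c f m : f \is c.-homog -> (c + mdeg m)%N = n ->
  K (f * Sq 'X_[m]) = K (f * 'X_[m]).
Proof.
move=> hf e; rewrite (KM_supp (b0 := m) hf) ?mcoeff_Sq_low ?mul1r // => b hb ne.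
by have := msupp_Sq_low hb ne; lia.
Qed.

(** The highest part of [Sq] on a monomial is its square, and in this degree [K] sees no other
    part. *)
Lemma KM_Sq_top c f m : f \is c.-homog -> (c + (mdeg m).*2)%N = n ->
  K (f * Sq 'X_[m]) = K (f * 'X_[m] ^+ 2).
Proof.
move=> hf e; rewrite (KM_supp (b0 := (m + m)%MM) hf) => [|b hb ne].
  by rewrite mcoeff_Sq_top mul1r mpolyXD expr2.
by have := msupp_Sq_top hb ne; lia.
Qed.

Lemma Kbig d f g : f \is d.-homog -> (n < d)%N -> K (f * g) = 0.
Proof.
move=> hf lt; elim/mp_add_ind: g => [|m|g1 g2 I1 I2].
- by rewrite mulr0 K0.
- apply: (@Khomog (d + mdeg m)); last by lia.
  by apply: dhomogM => //; apply: mon_homog.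
- by rewrite mulrDr (KD HK) I1 I2 addr0.
Qed.

(* The truncated inverse of [Sq] on a variable: [Sq] maps it to ['X_i + 'X_i ^+ (2 ^ M)], and the
   second term is invisible in low degrees. *)
Definition powsum M (i : 'I_k) : P k := \sum_(j < M) 'X_i ^+ (2 ^ j).

Lemma powsumS M i : powsum M.+1 i = 'X_i + powsum M i ^+ 2.
Proof.
rewrite /powsum big_ord_recl expr1 mp_sqr_sum; congr (_ + _).
by apply: eq_bigr => j _; rewrite -exprM -expnSr.
Qed.

Lemma Sq_powsum M i : Sq (powsum M i) = 'X_i + 'X_i ^+ (2 ^ M).
Proof.
elim: M => [|M IH]; first by rewrite /powsum big_ord0 Sq0 expn0 expr1 mp_addxx.
rewrite powsumS SqD SqXn IH SqX mp_sqrD -exprM -expnSr.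
by rewrite -addrA [X in _ + X]addrA mp_addxx add0r.
Qed.

(** Invariance moves [Sq] to the other factor as its inverse, the conjugate total square. The error
    terms of the truncation are divisible by some ['X_i ^+ (2 ^ M)] and exceed degree [n]. *)
Lemma K_xprod_Sq J g M : (n < 2 ^ M)%N ->
  K (xprod J * Sq g) = K (\prod_(i in J) powsum M i * g).
Proof.
move=> hM; rewrite -[RHS](KSq HK) SqM Sq_prod.
under eq_bigr => i _ do rewrite Sq_powsum.
rewrite prod_add_set mulr_suml Ksum (bigD1 J) //= setDv big_set0 mulr1.
rewrite [X in _ + X]big1 ?addr0 // => L /andP[LJ nL].
have /set0Pn [i] : J :\: L != set0.
  by apply: contra nL; rewrite setD_eq0 => JL; rewrite eqEsubset LJ.
move=> iJL; rewrite [X in _ * X * _](bigD1 i iJL) /= mulrCA -!mulrA.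
apply: (@Kbig (2 ^ M)) => //.
by have := dhomogMn (2 ^ M) (X_homog i); rewrite mul1n.
Qed.

(** Each truncated inverse is a variable plus a square, so the product expands over possible first
    rows [L]. The term [L = J] is [K (xprod J * g ^+ 2)]; all others have a smaller first row. *)
Lemma K_xprod_sqr J g : K (xprod J * Sq g ^+ 2) =
  \sum_(L : {set 'I_k} | L \subset J) K (xprod L * (\prod_(i in J :\: L) powsum n i * g) ^+ 2).
Proof.
have hM : (n < 2 ^ n.+1)%N by rewrite ltnW // ltn_expl.
rewrite -SqXn (K_xprod_Sq _ _ hM).
under eq_bigr => i _ do rewrite powsumS.
rewrite prod_add_sqr mulr_suml Ksum; apply: eq_bigr => L _.
by rewrite -mulrA -exprMn.
Qed.

Lemma K_parity J g : odd #|J| != odd n -> K (xprod J * g ^+ 2) = 0.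
Proof.
move=> ne; elim/mp_add_ind: g => [|m|g1 g2 I1 I2].
- by rewrite expr0n mulr0 K0.
- apply: (@Khomog (#|J| + mdeg m * 2)).
    by apply: dhomogM; [apply: xprod_homog | apply: dhomogMn; rewrite dhomogX].
  by apply: contra ne => /eqP <-; rewrite oddD muln2 odd_double addbF.
- by rewrite mp_sqrD mulrDr (KD HK) I1 I2 addr0.
Qed.

End Functionals.

(** * Fixing the first row *)

Definition low_vanish (w n : nat) := forall k (K : P k -> 'F_2), hitfree n K ->
  forall (J : {set 'I_k}) g, (#|J| < w)%N -> K (xprod J * g ^+ 2) = 0.

Definition krow k (K : P k -> 'F_2) (J : {set 'I_k}) : P k -> 'F_2 :=
  fun g => K (xprod J * g ^+ 2).

Section Rows.
Variables (k w n' : nat) (K : P k -> 'F_2).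
Let n := (w + n'.*2)%N.
Hypothesis HK : hitfree n K.
Hypothesis lv : low_vanish w n.

(** In [K_xprod_sqr] every term but [L = J] has a first row of size below [w] and vanishes, so
    invariance passes to the remaining rows. *)
Lemma krow_hitfree (J : {set 'I_k}) : #|J| = w -> hitfree n' (krow K J).
Proof.
move=> Jw; split=> [f g|f|m nm]; rewrite /krow.
- by rewrite mp_sqrD mulrDr (KD HK).
- rewrite (K_xprod_sqr HK) (bigD1 J) //= setDv big_set0 mul1r.
  rewrite big1 ?addr0 // => L /andP[LJ nL]; apply: lv => //.
  by rewrite -Jw proper_card // properEneq nL.
- apply: (@Khomog _ _ _ HK (#|J| + mdeg m * 2)).
    by apply: dhomogM; [apply: xprod_homog | apply: dhomogMn; rewrite dhomogX].
  by rewrite Jw /n; lia.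
Qed.

Lemma sum_subsets1 (V : nmodType) (I : {set 'I_k}) (F : {set 'I_k} -> V) : #|I| = w.+1 ->
  \sum_(L : {set 'I_k} | (L \subset I) && (#|L| == w)) F L = \sum_(i in I) F (I :\ i).
Proof.
move=> Iw; transitivity (\sum_(L in [set I :\ i | i in I]) F L); last first.
  rewrite big_imset // => i j iI jI e; apply/eqP; apply: contraTT iI => ne.
  have : i \notin I :\ i by rewrite !inE eqxx.
  by rewrite e !inE ne.
apply: eq_bigl => L; apply/andP/imsetP => [[LI /eqP Lw]|[i iI ->]].
  have : #|I :\: L| = 1%N by rewrite cardsD (setIidPr LI) Iw Lw subSnn.
  move/eqP/cards1P => [i e]; exists i; first by have := set11 i; rewrite -e inE => /andP[].
  by rewrite -e setDDr setDv set0U (setIidPr LI).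
split; first exact: subD1set.
by have := cardsD1 i I; rewrite iI Iw => -[->].
Qed.

(** This is [Sq^1] on [xprod I * g ^+ 2]. First rows of size [w.+1] vanish by parity and those below
    [w] by [lv]; a first row [I :\ i] leaves the factor ['X_i] to the rows below it. *)
Lemma krow_rel (I : {set 'I_k}) g : #|I| = w.+1 -> \sum_(i in I) krow K (I :\ i) ('X_i * g) = 0.
Proof.
move=> Iw; have card i : i \in I -> #|I :\ i| = w.
  by move=> iI; have := cardsD1 i I; rewrite iI Iw => -[->].
elim/mp_add_ind: g => [|m|g1 g2 I1 I2].
- by rewrite big1 // => i iI; rewrite mulr0 (K0 (krow_hitfree (card i iI))).
- have par h : K (xprod I * h ^+ 2) = 0.
    by apply: (K_parity HK); rewrite Iw /n oddD odd_double addbF /=; case: odd.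
  have [e|ne] := eqVneq (mdeg m).+1 n'; last first.
    rewrite big1 // => i iI; apply: (Khomog (krow_hitfree (card i iI)) _ ne).
    exact: (dhomogM (X_homog i) (mon_homog m)).
  rewrite -[RHS](par 'X_[m]) -[RHS](KSq HK) SqM SqXn Sq_xprod mulr_suml (Ksum HK).
  rewrite (bigID (fun L : {set 'I_k} => #|L| == w)) /=.
  rewrite sum_subsets1 // [X in _ = _ + X]big1 ?addr0 => [|L /andP[LI Lw]].
    apply: eq_bigr => i iI; rewrite -mulrA -exprMn.
    have -> : I :\: (I :\ i) = [set i].
      by rewrite setDDr setDv set0U; apply/setIidPr; rewrite sub1set.
    rewrite {2}/xprod big_set1 -[RHS]/(krow K _ _).
    rewrite (KM_Sq_low (krow_hitfree (card i iI)) (c := 1)) ?X_homog //.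
  rewrite -mulrA -exprMn.
  have [|lt] := ltnP #|L| w; first exact: lv.
  have -> : L = I; last exact: par.
  apply/eqP; rewrite eqEcard LI Iw ltn_neqAle eq_sym Lw //=.
- under eq_bigr => i iI do rewrite mulrDr (KD (krow_hitfree (card i iI))).
  by rewrite big_split /= I1 I2 addr0.
Qed.

End Rows.

(** * Relations between rows *)

(** The degree of [r] rows of size [w] followed by a monomial of degree [N]. *)
Fixpoint row_degree (w N r : nat) : nat :=
  if r is r'.+1 then (w + (row_degree w N r').*2)%N else N.

Fixpoint rows k (T : seq {set 'I_k}) (g : P k) : P k :=
  if T is J :: T' then xprod J * rows T' g ^+ 2 else g.

Lemma rows_cat k (T T' : seq {set 'I_k}) g : rows (T ++ T') g = rows T (rows T' g).
Proof. by elim: T => //= J T ->. Qed.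

Lemma big_setD0 (V : nmodType) (T : finType) (I A : {set T}) (F : T -> V) :
  (forall i, i \in I -> i \in A -> F i = 0) ->
  \sum_(i in I) F i = \sum_(i in I :\: A) F i.
Proof.
move=> h; rewrite (big_setID A) /= big1 ?add0r // => i /setIP[]; exact: h.
Qed.

Lemma big_cond0 (V : nmodType) (T : finType) (p q : pred T) (F : T -> V) :
  (forall i, p i -> ~~ q i -> F i = 0) ->
  \sum_(i | p i) F i = \sum_(i | p i && q i) F i.
Proof.
move=> h; rewrite (bigID q) /= [X in _ + X]big1 ?addr0 // => i /andP[]; exact: h.
Qed.

Lemma big_add0 (V : nmodType) (T : finType) (p : pred T) (F G H : T -> V) :
  (forall i, H i = F i + G i) -> \sum_(i | p i) F i = 0 -> \sum_(i | p i) G i = 0 ->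
  \sum_(i | p i) H i = 0.
Proof. by move=> h F0 G0; rewrite (eq_bigr _ (fun i _ => h i)) big_split /= F0 G0 addr0. Qed.

Lemma big_pair (V : nmodType) (T : finType) (a b : T) (F : T -> V) : a != b ->
  \sum_(i in [set a; b]) F i = F a + F b.
Proof. by move=> ab; rewrite big_setU1 ?inE //= big_set1. Qed.

Section Level.
Variables (k w N : nat).
Hypothesis lvs : forall r, low_vanish w (row_degree w N r.+1).
Implicit Types (K : P k -> 'F_2) (I J A B : {set 'I_k}) (T : seq {set 'I_k}) (g h : P k).

Let wsets T := all (fun J => #|J| == w) T.

Lemma lrow_hitfree K r J : hitfree (row_degree w N r.+1) K -> #|J| = w ->
  hitfree (row_degree w N r) (krow K J).
Proof. by move=> HK hJ; apply: (krow_hitfree (n' := row_degree w N r) HK _ hJ); apply: (@lvs r). Qed.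

Lemma lrow_rel K r I g : hitfree (row_degree w N r.+1) K -> #|I| = w.+1 ->
  \sum_(i in I) krow K (I :\ i) ('X_i * g) = 0.
Proof. by move=> HK hI; apply: (krow_rel (n' := row_degree w N r) HK _ _ hI); apply: (@lvs r). Qed.

Lemma rows_hitfree T K r : wsets T -> hitfree (row_degree w N (size T + r)) K ->
  hitfree (row_degree w N r) (fun g => K (rows T g)).
Proof.
elim: T K => [|J T IH] K //= /andP[/eqP hJ hT] HK.
exact: (IH (krow K J) hT (lrow_hitfree HK hJ)).
Qed.

Lemma X_xprod_sqr i A h : 'X_i * (xprod A * h ^+ 2) =
  if i \in A then xprod (A :\ i) * ('X_i * h) ^+ 2 else xprod (i |: A) * h ^+ 2.
Proof.
case: ifP => [iA|/negbT iA]; last by rewrite xprodU1 // mulrA.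
by rewrite (xprodD1 iA) exprMn [RHS]mulrCA ['X_i ^+ 2]expr2 -!mulrA.
Qed.

(** Take [xprod A * h ^+ 2] for [g] in [lrow_rel]. For [i] in [A] a carry leaves a row of size
    [w - 2], which gives zero; the other terms form a Pluecker relation between neighbouring
    rows. *)
Lemma quad_rel K r I A h : hitfree (row_degree w N r.+2) K -> #|I| = w.+1 -> #|A|.+1 = w ->
  \sum_(i in I :\: A) K (rows [:: I :\ i; i |: A] h) = 0.
Proof.
move=> HK hI hA.
have h0 i : i \in I -> i \in A -> krow K (I :\ i) ('X_i * (xprod A * h ^+ 2)) = 0.
  move=> iI iA; have hIi : #|I :\ i| = w by have := cardsD1 i I; rewrite iI hI => -[->].
  rewrite X_xprod_sqr iA; apply: (lvs (lrow_hitfree HK hIi)).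
  by rewrite -hA (cardsD1 i A) iA ltnS add1n ltnW.
apply: etrans (etrans (esym (big_setD0 h0)) (lrow_rel _ HK hI)).
by apply: eq_bigr => i /setDP[_ iA]; rewrite X_xprod_sqr (negbTE iA).
Qed.

(** Here the second row is [I] itself, so ['X_i] is carried through it into the third row. If [i]
    lies in [B] it is carried once more and leaves a row that is too small. *)
Lemma cubic_rel K r I B h : hitfree (row_degree w N r.+3) K -> #|I| = w.+1 -> #|B|.+1 = w ->
  \sum_(i in I :\: B) K (rows [:: I :\ i; I :\ i; i |: B] h) = 0.
Proof.
move=> HK hI hB.
have hIi i : i \in I -> #|I :\ i| = w.
  by move=> iI; have := cardsD1 i I; rewrite iI hI => -[->].
have h0 i : i \in I -> i \in B ->
    krow K (I :\ i) ('X_i * (xprod I * (xprod B * h ^+ 2) ^+ 2)) = 0.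
  move=> iI iB; rewrite X_xprod_sqr iI X_xprod_sqr iB.
  apply: (lvs (@rows_hitfree [:: I :\ i; I :\ i] K r.+1 _ HK)); first by rewrite /= !hIi // eqxx.
  by rewrite -hB (cardsD1 i B) iB ltnS add1n ltnW.
apply: etrans (etrans (esym (big_setD0 h0)) (lrow_rel _ HK hI)).
by apply: eq_bigr => i /setDP[iI iB]; rewrite X_xprod_sqr iI X_xprod_sqr (negbTE iB).
Qed.

(** When [I] and [J] differ by one exchange, [quad_rel] for their union and intersection has only
    two terms. *)
Lemma swap_adj K r I J h : hitfree (row_degree w N r.+2) K -> #|I| = w -> #|J| = w ->
  #|I :&: J|.+1 = w -> K (rows [:: I; J] h) = K (rows [:: J; I] h).
Proof.
move=> HK hI hJ hIJ.
have /eqP/cards1P [a Ea] : #|I :\: J| = 1%N by rewrite cardsD; lia.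
have /eqP/cards1P [b Eb] : #|J :\: I| = 1%N by rewrite cardsD setIC; lia.
have /setDP [aI aJ] : a \in I :\: J by rewrite Ea set11.
have /setDP [bJ bI] : b \in J :\: I by rewrite Eb set11.
have ab : a != b by apply: contraNneq bI => <-.
have hU : #|I :|: J| = w.+1 by rewrite cardsU; lia.
have Ja : (I :|: J) :\ a = J.
  apply/setP => x; move/setP: Ea => /(_ x); rewrite !inE => <-.
  by case: (x \in I); case: (x \in J).
have Ib : (I :|: J) :\ b = I.
  apply/setP => x; move/setP: Eb => /(_ x); rewrite !inE => <-.
  by case: (x \in I); case: (x \in J).
have Ia : a |: I :&: J = I.
  apply/setP => x; move/setP: Ea => /(_ x); rewrite !inE => <-.
  by case: (x \in I); case: (x \in J).
have Jb : b |: I :&: J = J.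
  apply/setP => x; move/setP: Eb => /(_ x); rewrite !inE => <-.
  by case: (x \in I); case: (x \in J).
have EU : (I :|: J) :\: (I :&: J) = [set a; b].
  apply/setP => x; move/setP: Ea => /(_ x); move/setP: Eb => /(_ x); rewrite !inE => <- <-.
  by case: (x \in I); case: (x \in J).
pose F i := K (rows [:: (I :|: J) :\ i; i |: (I :&: J)] h).
have E : F a + F b = 0 by rewrite -(big_pair F ab) -EU; exact: quad_rel h HK hU hIJ.
have := esym (F2_add_eq0 E).
by rewrite /F Ja Ib Ia Jb.
Qed.

Definition rows_commute r := forall K, hitfree (row_degree w N r) K -> forall I J h,
  #|I| = w -> #|J| = w -> K (rows [:: I; J] h) = K (rows [:: J; I] h).

Lemma swap_hyper r : (0 < w)%N -> (k <= w.+1)%N -> rows_commute r.+2.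
Proof.
move=> w0 kw K HK I J h hI hJ; have [->//|ne] := eqVneq I J.
apply: (swap_adj h HK) => //.
have : (#|I :|: J| <= k)%N by rewrite -[X in (_ <= X)%N]card_ord max_card.
have : (#|I :&: J| < w)%N.
  rewrite ltn_neqAle -{2}hI subset_leq_card ?subsetIl // andbT.
  apply: contra ne => /eqP e.
  rewrite eqEcard hI hJ leqnn andbT; apply/setIidPl/eqP.
  by rewrite eqEcard subsetIl e hI leqnn.
by rewrite cardsU; lia.
Qed.

Section Perm.
Variable r : nat.
Hypothesis swp : forall r', (r.+2 <= r')%N -> rows_commute r'.

Lemma rows_bubble K J T1 T2 h : hitfree (row_degree w N (size (J :: T1 ++ T2) + r)) K ->
  #|J| = w -> wsets T1 -> K (rows (T1 ++ J :: T2) h) = K (rows (J :: T1 ++ T2) h).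
Proof.
elim: T1 K => [//|L T1 IH] K HK hJ /andP[/eqP hL hT1].
have HL : hitfree (row_degree w N (size (J :: T1 ++ T2) + r)) (krow K L) := lrow_hitfree HK hL.
have e1 : K (rows (L :: T1 ++ J :: T2) h) = K (rows [:: L, J & T1 ++ T2] h).
  exact: IH (krow K L) HL hJ hT1.
have HK' : hitfree (row_degree w N (size (T1 ++ T2) + r).+2) K := HK.
apply: etrans e1 _; apply: (swp _ HK') => //; lia.
Qed.

Lemma rows_perm K T T' h : hitfree (row_degree w N (size T + r)) K -> wsets T ->
  perm_eq T T' -> K (rows T h) = K (rows T' h).
Proof.
elim: T T' K => [|J T IH] T' K HK /=; first by move=> _ /perm_size/esym/size0nil ->.
case/andP=> /eqP hJ hT pT; have JT' : J \in T' by rewrite -(perm_mem pT) mem_head.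
case/splitPr: JT' pT => T1 T2 pT.
have {}pT : perm_eq T (T1 ++ T2).
  by rewrite -(perm_cons J) (perm_trans pT) // perm_catC /= perm_cons perm_catC.
have hT1 : wsets T1 by move: hT; rewrite /wsets (perm_all _ pT) all_cat => /andP[].
rewrite rows_bubble //=; last by rewrite -(perm_size pT).
by apply: (IH _ (krow K J)) => //; apply: lrow_hitfree.
Qed.

End Perm.

(* A row of size [w.+2 = k] below a row [I] is traded, by [lrow_rel] for [a |: I] with [a] outside
   of [I], for rows of size [w]. *)
Lemma det2 K r : (k <= w.+2)%N -> hitfree (row_degree w N r.+2) K ->
  (forall I J h, #|I| = w -> #|J| = w -> K (rows [:: I; J] h) = 0) ->
  forall I g, #|I| = w -> K (xprod I * g ^+ 2) = 0.
Proof.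
move=> kw HK h0 I g hI; have HI := lrow_hitfree HK hI.
rewrite -[LHS]/(krow K I g); elim/mp_split_ind: g => [|J m|g1 g2 I1 I2].
- exact: K0 HI.
- have [lt|ge] := ltnP #|J| w; first exact: (lvs HI).
  have [e|ne] := eqVneq #|J| w; first exact: (h0 I J).
  have [e|ne1] := eqVneq #|J| w.+1.
    by apply: (K_parity HI); rewrite e /= oddD odd_double addbF; case: odd.
  have JT : J = setT.
    apply/eqP; rewrite eqEcard subsetT cardsT card_ord; lia.
  have cJ : #|J| = k by rewrite JT cardsT card_ord.
  have kE : k = w.+2 by lia.
  have /subsetPn [a _ aI] : ~~ (setT \subset I).
    by apply: contraTN isT => /subset_leq_card; rewrite cardsT card_ord; lia.
  have hU : #|a |: I| = w.+1 by rewrite cardsU1 aI hI.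
  have := lrow_rel (xprod (setT :\ a) * 'X_[m] ^+ 2) HK hU.
  rewrite big_setU1 //= setU1K // X_xprod_sqr !inE eqxx /= setD1K ?inE // -JT.
  rewrite big1 ?addr0 // => i iI; have ia : i != a by apply: contraNneq aI => <-.
  have aJ : a \in J by rewrite JT inE.
  have iJ : i \in J :\ a by rewrite JT !inE ia.
  rewrite X_xprod_sqr iJ; apply: (h0 _ (J :\ a :\ i) ('X_i * 'X_[m])).
    by have := cardsD1 i (a |: I); rewrite hU !inE iI orbT => -[->].
  by have := cardsD1 a J; have := cardsD1 i (J :\ a); rewrite aJ iJ cJ !add1n => -> e2; apply/eqP; rewrite -eqSS -(eqSS _.+1) -e2 kE.
- by rewrite (KD HI) I1 I2 addr0.
Qed.

(** [det2] reduces to two rows of size [w], and the induction hypothesis applies below the first of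
    them. *)
Lemma det_rows D K r : (k <= w.+2)%N -> hitfree (row_degree w N (D.+1 + r)) K ->
  (forall T h, size T = D.+1 -> wsets T -> K (rows T h) = 0) ->
  forall I g, #|I| = w -> K (xprod I * g ^+ 2) = 0.
Proof.
move=> kw; elim: D K => [|D IH] K HK h0 I g hI.
  by apply: (h0 [:: I]) => //=; rewrite hI eqxx.
apply: (det2 kw HK) => // {hI}I J h hI hJ.
apply: (IH (krow K I)) => // [|T h' sT wT].
  by apply: lrow_hitfree.
by apply: (h0 (I :: T)); rewrite /= ?sT ?hI ?eqxx.
Qed.

End Level.

(** * Exchanging rows of size 3 in five variables *)

Section Five.
Variable N : nat.
Hypothesis lvs : forall r, low_vanish 3 (row_degree 3 N r.+1).
Implicit Types (K : P 5 -> 'F_2) (I J A B : {set 'I_5}) (g h : P 5).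

Lemma pow4E (R : comPzRingType) (u v : R) : (u ^+ 2 * v ^+ 2) ^+ 2 = (u * v) ^+ 4.
Proof. by rewrite -exprMn -exprM. Qed.

Lemma mp_pow4D k (f g : P k) : (f + g) ^+ 4 = f ^+ 4 + g ^+ 4.
Proof. by rewrite -[4%N]/(2 * 2)%N !exprM !mp_sqrD. Qed.

(** The fourth power is the top part of [Sq] on a square; moving [Sq] to the full row leaves first
    rows [L]. Those of size 3 leave two factors with exponents [2 ^ p] and [2 ^ q], whose degree the
    arithmetic hypothesis excludes; the other sizes fail by parity, degree or [low_vanish]. *)
Lemma K_full_pow4 K n g : hitfree n K -> low_vanish 3 n ->
  (forall p q e, 5 + e * 4 = n -> 3 + 2 * (2 ^ p + 2 ^ q + e) = n -> False)%N ->
  odd n -> (5 < n)%N ->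
  K (xprod setT * g ^+ 4) = 0.
Proof.
move=> HK lv ar on n5; elim/mp_add_ind: g => [|m|g1 g2 I1 I2].
- by rewrite expr0n mulr0 (K0 HK).
- have hh d : ('X_[m] ^+ d : P 5) \is (mdeg m * d)%N.-homog.
    exact: dhomogMn (mon_homog m).
  have hT : xprod [set: 'I_5] \is 5.-homog by have := xprod_homog [set: 'I_5]; rewrite cardsT card_ord.
  have [e|ne] := eqVneq (5 + mdeg m * 4)%N n; last first.
    by apply: (Khomog HK _ ne); apply: dhomogM.
  have -> : 'X_[m] ^+ 4 = 'X_[(m + m)%MM] ^+ 2 :> P 5 by rewrite mpolyXD -expr2 -exprM.
  rewrite -(KM_Sq_top HK (c := 5)) //; last by rewrite mdegD; lia.
  rewrite mpolyXD -expr2 SqXn (K_xprod_sqr HK) big1 // => L _.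
  have [lt|ge] := ltnP #|L| 3%N; first exact: lv HK _ _ lt.
  have [e5|ne5] := eqVneq L setT.
    rewrite e5 setDv big_set0 mul1r; apply: (Khomog HK (dhomogM hT (hh 2))); lia.
  have [e4|ne4] := eqVneq #|L| 4%N; first by apply: (K_parity HK); rewrite e4 on.
  have L3 : #|L| = 3%N.
    have : #|L| != 5%N by apply: contra ne5 => /eqP e5; rewrite eqEcard subsetT cardsT card_ord e5.
    by have := subset_leq_card (subsetT L); rewrite cardsT card_ord; lia.
  have /cards2P [a [b [ab ->]]] : #|[set: 'I_5] :\: L| == 2%N.
    by rewrite cardsD cardsT card_ord setTI L3.
  rewrite big_setU1 ?inE //= big_set1 /powsum mulr_suml !mulr_suml mp_sqr_sum mulr_sumr.
  rewrite (Ksum HK) big1 // => p _.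
  rewrite mulr_sumr mulr_suml mp_sqr_sum mulr_sumr (Ksum HK) big1 // => q _.
  have hX i j : ('X_i ^+ (2 ^ j) : P 5) \is (2 ^ j)%N.-homog.
    by have := dhomogMn (2 ^ j) (X_homog i); rewrite mul1n.
  apply: (Khomog HK (dhomogM (xprod_homog L)
     (dhomogMn 2 (dhomogM (dhomogM (hX a p) (hX b q)) (mon_homog m))))).
  by apply/eqP => e'; apply: (ar p q (mdeg m)); lia.
- by rewrite mp_pow4D mulrDr; apply: (K_add0 HK).
Qed.

Lemma Sq2_rel K n h (a : 'I_5) :
  let n2 := (3 + n.*2)%N in let n3 := (3 + n2.*2)%N in
  hitfree n3 K -> low_vanish 3 n3 -> low_vanish 3 n2 ->
  (forall g, K (xprod setT * g ^+ 4) = 0) ->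
  \sum_(J : {set 'I_5} | (#|J| == 3%N) && (a \in J)) K (rows [:: J; a |: ~: J] h) = 0.
Proof.
move=> n2 n3 HK lv3 lv2 z5.
pose f J := K (xprod J * (xprod (~: J) * ('X_a * h ^+ 2)) ^+ 2).
have fE J : #|J| == 3%N -> a \in J -> f J = K (rows [:: J; a |: ~: J] h).
  by move=> _ aJ; rewrite /f [xprod (~: J) * _]mulrCA mulrA -xprodU1 ?inE ?aJ.
have f0 J : #|J| == 3%N -> a \notin J -> f J = 0.
  move=> /eqP J3 aJ; rewrite /f.
  have HJ := krow_hitfree HK lv3 J3.
  have -> : xprod (~: J) * ('X_a * h ^+ 2) = xprod (~: J :\ a) * ('X_a * h) ^+ 2.
    by rewrite [LHS]mulrCA X_xprod_sqr !inE aJ.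
  apply: (lv2 _ _ HJ); apply: leq_ltn_trans (subset_leq_card (subD1set _ _)) _.
  by rewrite cardsCs setCK card_ord J3.
suff : \sum_(J : {set 'I_5} | #|J| == 3%N) f J = 0.
  move=> E; apply: etrans (etrans (esym (big_cond0 f0)) E).
  by apply: eq_bigr => J /andP[J3 aJ]; rewrite fE.
rewrite /f; clear f fE f0.
elim/mp_add_ind: h => [|m|g1 g2 I1 I2].
- by rewrite big1 // => J _; rewrite expr0n !mulr0 expr0n mulr0 (K0 HK).
- have hm : ('X_[m] ^+ 2 : P 5) \is (mdeg m * 2)%N.-homog by exact: dhomogMn (mon_homog m).
  have hT : xprod [set: 'I_5] \is 5.-homog by have := xprod_homog [set: 'I_5]; rewrite cardsT card_ord.
  have hb J : xprod (~: J) \is (5 - #|J|)%N.-homog.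
    by have := xprod_homog (~: J); rewrite cardsCs setCK card_ord.
  have [e|ne] := eqVneq (3 + (2 + (1 + mdeg m * 2)) * 2)%N n3; last first.
    rewrite big1 // => J /eqP J3; apply: (Khomog HK _ ne).
    have h1 := xprod_homog J; rewrite J3 in h1; have h2 := hb J; rewrite J3 in h2.
    exact: (dhomogM h1 (dhomogMn 2 (dhomogM h2 (dhomogM (X_homog a) hm)))).
  have on : odd n3 by rewrite /n3 oddD odd_double.
  have par J g : ~~ odd #|J| -> K (xprod J * g ^+ 2) = 0.
    by move=> oJ; apply: (K_parity HK); rewrite on (negbTE oJ).
  have zero : K (xprod setT * ('X_a * 'X_[m] ^+ 2) ^+ 2) = 0.
    apply: (Khomog HK (dhomogM hT (dhomogMn 2 (dhomogM (X_homog a) hm)))); lia.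
  pose G L := K (xprod L * (xprod (~: L) * Sq ('X_a * 'X_[m] ^+ 2)) ^+ 2).
  have EG : \sum_(L : {set 'I_5}) G L = 0.
    apply: (etrans _ zero); rewrite -[RHS](KSq HK) SqM SqXn Sq_xprod mulr_suml (Ksum HK).
    apply: eq_big => [L|L _]; first by rewrite subsetT.
    by rewrite /G setTD exprMn mulrA.
  have G0 (L : {set 'I_5}) : true -> ~~ (#|L| == 3%N) -> G L = 0.
    move=> _ L3; rewrite /G.
    have [lt|ge] := ltnP #|L| 3%N; first exact: lv3 HK _ _ lt.
    have [e4|ne4] := eqVneq #|L| 4%N; first by apply: par; rewrite e4.
    have -> : L = setT.
      by apply/eqP; rewrite eqEcard subsetT cardsT card_ord; lia.
    rewrite setCT /xprod big_set0 mul1r -/(xprod _).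
    (* With the full first row, the first summand lies in degrees that are 3 modulo 4, whereas [n3]
       is 1 modulo 4. The second summand is a fourth power, covered by [z5]. *)
    have -> : Sq ('X_a * 'X_[m] ^+ 2) ^+ 2 =
        'X_a ^+ 2 * Sq 'X_[m] ^+ 4 + ('X_a * Sq 'X_[m]) ^+ 4 :> P 5.
      by rewrite SqM SqXn SqX mulrDl mp_sqrD pow4E exprMn -exprM.
    rewrite mulrDr; apply: (K_add0 HK); last exact: z5.
    rewrite mulrA.
    have h7 := dhomogM hT (dhomogMn 2 (X_homog a)).
    elim/mp_add_ind: (Sq 'X_[m]) => [|c|g1 g2 I1 I2].
    + by rewrite expr0n mulr0 (K0 HK).
    + by apply: (Khomog HK (dhomogM h7 (dhomogMn 4 (mon_homog c)))); lia.
    + by rewrite mp_pow4D mulrDr; apply: (K_add0 HK).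
  apply: etrans (etrans (esym (big_cond0 G0)) EG); apply: eq_bigr => J /= J3.
  rewrite /G.
  have HJ := krow_hitfree HK lv3 (eqP J3); rewrite -[LHS]/(krow K J _) -[RHS]/(krow K J _).
  have cJ : #|~: J| = 2%N by rewrite cardsCs setCK card_ord (eqP J3).
  have h3 : xprod (~: J) * 'X_a \is 3.-homog.
    by have := dhomogM (xprod_homog (~: J)) (X_homog a); rewrite cJ.
  (* The last summand has second row [~: J], of size 2, and vanishes. *)
  have -> : xprod (~: J) * Sq ('X_a * 'X_[m] ^+ 2) =
      xprod (~: J) * 'X_a * Sq 'X_[(m *+ 2)%MM] + xprod (~: J) * ('X_a * Sq 'X_[m]) ^+ 2.
    by rewrite SqM -mpolyXn !SqXn SqX mulrDl mulrDr mulrA exprMn.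
  rewrite (KD HJ) (lv2 _ _ HJ) ?cJ // addr0.
  rewrite (KM_Sq_low HJ h3); last by rewrite mdegMn /n2; lia.
  by rewrite -mulrA mpolyXn.
- have h2 J : K (xprod J * (xprod (~: J) * ('X_a * (g1 + g2) ^+ 2)) ^+ 2) =
    K (xprod J * (xprod (~: J) * ('X_a * g1 ^+ 2)) ^+ 2) +
    K (xprod J * (xprod (~: J) * ('X_a * g2 ^+ 2)) ^+ 2).
    by rewrite mp_sqrD !mulrDr mp_sqrD mulrDr (KD HK).
  exact: big_add0 h2 I1 I2.
Qed.

(* Writing [f J] for the summands of [Sq2_rel], the relations [quad_rel] say that the sum of the
   [f J] over the [J] containing [a] but not [u] vanishes, for each [u <> a]; eliminating [u] and
   then [v] leaves [f {a,u,v} = f {a,x,y}] where [x, y] are the two remaining indices. *)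
Lemma swap_meet1 K r I J h :
  hitfree (row_degree 3 N r.+2) K -> (forall g, K (xprod setT * g ^+ 4) = 0) ->
  #|I| = 3%N -> #|J| = 3%N -> #|I :&: J| = 1%N ->
  K (rows [:: I; J] h) = K (rows [:: J; I] h).
Proof.
move=> HK z5 I3 J3 /eqP/cards1P [a Ea].
have aIJ : a \in I :&: J by rewrite Ea set11.
have /setIP [aI aJ] := aIJ.
have IUJ : I :|: J = setT.
  by apply/eqP; rewrite eqEcard subsetT cardsT card_ord cardsU I3 J3 Ea cards1.
have card2 : #|I :\ a| == 2%N by have /eqP := cardsD1 a I; rewrite I3 aI add1n eqSS eq_sym.
have /cards2P [u [v [uv Iuv]]] := card2.
have JE : J = a |: ~: I.
  apply/setP => x; move/setP: IUJ => /(_ x); move/setP: Ea => /(_ x); rewrite !inE.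
  by case: (x \in I); case: (x \in J) => //= <-.
have IE : I = a |: ~: J.
  apply/setP => x; move/setP: IUJ => /(_ x); move/setP: Ea => /(_ x); rewrite !inE.
  by case: (x \in I); case: (x \in J) => //= <-.
pose f L := K (rows [:: L; a |: ~: L] h).
suff E : f I + f J = 0.
  by move: (F2_add_eq0 E); rewrite /f -JE -IE.
pose F (L : {set 'I_5}) := if a \in L then f L else 0.
have S2 : \sum_(L : {set 'I_5} | #|L| == 3%N) F L = 0.
  have := @Sq2_rel K (row_degree 3 N r) h a HK (@lvs r.+1) (@lvs r) z5.
  by apply: etrans; rewrite [RHS]big_mkcondr.
have Q x : x != a -> \sum_(L : {set 'I_5} | (#|L| == 3%N) && (x \notin L)) F L = 0.
  move=> xa; have c4 : #|[set: 'I_5] :\ x| = 4%N.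
    by apply/eqP; have /eqP := cardsD1 x [set: 'I_5]; rewrite inE cardsT card_ord add1n eqSS eq_sym.
  have c2 : #|[set a; x]|.+1 = 3%N by rewrite cards2 eq_sym xa.
  rewrite (eq_bigl (fun L : {set 'I_5} => (L \subset setT :\ x) && (#|L| == 3%N))); last first.
    by move=> L; rewrite subsetD1 subsetT andbC.
  rewrite sum_subsets1 //; apply: (etrans _ (quad_rel lvs h HK c4 c2)).
  rewrite (big_setD0 (A := [set a; x])) => [|i]; last first.
    by rewrite !inE => /andP[ix _]; rewrite (negbTE ix) orbF /F !inE => /eqP ->; rewrite eqxx.
  apply: eq_bigr => i; rewrite !inE negb_or => /andP[/andP[ia ix] _].
  rewrite /F !inE eq_sym ia eq_sym xa /f; congr (K (rows [:: _; _] h)).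
  by apply/setP => y; rewrite !inE; case: (y == a); case: (y == x); case: (y == i).
have uI : u \in I :\ a by rewrite Iuv !inE eqxx.
have vI : v \in I :\ a by rewrite Iuv !inE eqxx orbT.
have /setD1P [ua uI'] := uI; have /setD1P [va vI'] := vI.
have FI : F I = f I by rewrite /F aI.
have FJ : F J = f J by rewrite /F aJ.
have F0 (L : {set 'I_5}) : a \notin L -> F L = 0 by rewrite /F => /negbTE ->.
rewrite -FI -FJ; clear FI FJ; clearbody F.
have {}S2 : \sum_(L : {set 'I_5} | (#|L| == 3%N) && (u \in L)) F L = 0.
  by move: S2; rewrite (bigID (fun L : {set 'I_5} => u \in L)) /= (Q u) // addr0.
have uvL (L : {set 'I_5}) : I :\ a \subset L = (u \in L) && (v \in L).
  by rewrite Iuv subUset !sub1set.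
have EI : \sum_(L : {set 'I_5} | (#|L| == 3%N) && (u \in L) && (v \in L)) F L = F I.
  rewrite (bigD1 I) ?I3 ?uI' //= big1 ?addr0 // => L /andP[/andP[/andP[/eqP L3 uL] vL] nL].
  apply: F0; apply: contra nL => aL; rewrite eq_sym eqEcard I3 L3 leqnn andbT.
  by rewrite -(setD1K aI) subUset sub1set aL uvL uL.
have EJ : \sum_(L : {set 'I_5} | (#|L| == 3%N) && (v \notin L) && (u \notin L)) F L = F J.
  have uJ : u \notin J by rewrite JE !inE uI' (negbTE ua).
  have vJ : v \notin J by rewrite JE !inE vI' (negbTE va).
  rewrite (bigD1 J) ?J3 ?vJ ?uJ //= big1 ?addr0 // => L /andP[/andP[/andP[/eqP L3 vL] uL] nL].
  apply: F0; apply: contra nL => aL; rewrite eqEcard J3 L3 leqnn andbT.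
  rewrite JE; apply/subsetP => x xL; rewrite !inE; case: eqVneq => //= xa.
  apply: contraL xL => xI; have : x \in I :\ a by rewrite !inE xa.
  by rewrite Iuv !inE => /orP[] /eqP ->.
have := Q v va; rewrite (bigID (fun L : {set 'I_5} => u \in L)) /= EJ.
move: S2; rewrite (bigID (fun L : {set 'I_5} => v \in L)) /= EI.
under eq_bigl => L do rewrite andbAC.
by move=> /F2_add_eq0 ->.
Qed.

End Five.

(** * Vanishing on small first rows: arithmetic of the degrees *)

Lemma row_degree_closed w N r : (row_degree w N r + w = 2 ^ r * (N + w))%N.
Proof. by elim: r => [|r IH] /=; rewrite ?expn0 ?expnS; lia. Qed.

Lemma odd_row_degree w N r : odd (row_degree w N r.+1) = odd w.
Proof. by rewrite /= oddD odd_double addbF. Qed.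

Lemma low_vanish1 N r : low_vanish 1 (row_degree 1 N r.+1).
Proof.
move=> k K HK J g; rewrite ltnS leqn0 => /eqP J0.
by apply: (K_parity HK); rewrite J0 odd_row_degree.
Qed.

(** The case left by parity is the empty first row: [g ^+ 2] is the top part of [Sq g], and
    [K (Sq g) = K g] is zero because [g] has half the degree. *)
Lemma low_vanish2 N r : low_vanish 2 (row_degree 2 N r.+1).
Proof.
move=> k K HK J g J2; have [J1|J1] := eqVneq #|J| 1%N.
  by apply: (K_parity HK); rewrite J1 odd_row_degree.
have /eqP : #|J| = 0%N by lia.
rewrite cards_eq0 => /eqP ->; rewrite /xprod big_set0.
have h1 : (1 : P k) \is 0.-homog by exact: dhomog1.
elim/mp_add_ind: g => [|m|g1 g2 I1 I2].
- by rewrite expr0n mulr0 (K0 HK).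
- have [e|ne] := eqVneq (0 + (mdeg m).*2)%N (row_degree 2 N r.+1); last first.
    apply: (Khomog HK (dhomogM h1 (dhomogMn 2 (mon_homog m)))).
    by apply: contra ne => /eqP <-; lia.
  rewrite -(KM_Sq_top HK h1 e) mul1r (KSq HK).
  by apply: (Kdeg HK); move: e => /=; lia.
- by rewrite mp_sqrD mulrDr; apply: (K_add0 HK).
Qed.

Lemma pow2_mul_odd j s m : odd m -> (2 ^ j = 2 ^ s * m)%N -> m = 1%N.
Proof.
move=> om e; have : (m %| 2 ^ j)%N by rewrite e dvdn_mull.
have : coprime (2 ^ j)%N m by rewrite coprimeXl // prime_coprime // dvdn2 om.
by rewrite coprime_sym => /Gauss_dvdr h; rewrite -[(2 ^ j)%N]muln1 h dvdn1 => /eqP.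
Qed.

(** For [r = 0] the odd factor [2 ^ t + 1] would divide a power of 2. For [r > 0] the right side is
    even, so [j = 0], and it is too large to equal 2. *)
Lemma pow2_succ_neq s t r j : (0 < t)%N ->
  (2 ^ j + 1 <> 2 ^ r * (2 ^ (s + t) + 2 ^ s + 1))%N.
Proof.
move=> t0; case: r => [|r] e.
  have {}e : (2 ^ j = 2 ^ s * (2 ^ t + 1))%N by move: e; rewrite expnD; lia.
  have om : odd (2 ^ t + 1) by rewrite addn1 /= oddX orbF -lt0n.
  have := pow2_mul_odd om e.
  by have := expn_gt0 2 t; lia.
have [j0|j0] := posnP j; last first.
  by have := congr1 odd e; rewrite oddM oddD !oddX /= !orbF; case: (j) j0.
have := expn_gt0 2 s; have := expn_gt0 2 (s + t); have := expn_gt0 2 r.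
move: e; rewrite j0 expn0 expnS; nia.
Qed.

Section Arith3.
Variables s t : nat.
Hypothesis t0 : (0 < t)%N.
Let N := (2 ^ (s + t) + 2 ^ s - 2)%N.

Let levN r : (row_degree 3 N r + 3 = 2 ^ r * (2 ^ (s + t) + 2 ^ s + 1))%N.
Proof.
rewrite row_degree_closed; congr (_ * _)%N; rewrite /N.
have := expn_gt0 2 s; have := expn_gt0 2 (s + t); lia.
Qed.

(** Only a single variable as first row escapes parity. There the square is the top part of [Sq
    'X_[m]], and moving [Sq] over replaces ['X_i] by powers ['X_i ^+ (2 ^ j)]; the degrees would
    then give the equation excluded by [pow2_succ_neq]. *)
Lemma low_vanish3 r : low_vanish 3 (row_degree 3 N r.+1).
Proof.
move=> k K HK J g J3; have [ev|od] := boolP (odd #|J|); last first.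
  by apply: (K_parity HK); rewrite odd_row_degree (negbTE od).
have /cards1P [i ->] : #|J| == 1%N by case: #|J| J3 ev => [|[|[|]]].
elim/mp_add_ind: g => [|m|g1 g2 I1 I2].
- by rewrite expr0n mulr0 (K0 HK).
- have hi : xprod [set i] \is 1.-homog by have := xprod_homog [set i]; rewrite cards1.
  have [e|ne] := eqVneq (1 + (mdeg m).*2)%N (row_degree 3 N r.+1); last first.
    apply: (Khomog HK (dhomogM hi (dhomogMn 2 (mon_homog m)))).
    by apply: contra ne => /eqP <-; lia.
  rewrite -(KM_Sq_top HK hi e) (K_xprod_Sq HK _ _ (ltn_expl _ (ltnSn 1))).
  rewrite big_set1 mulr_suml (Ksum HK) big1 // => j _.
  have hx : ('X_i ^+ (2 ^ j) : P k) \is (2 ^ j)%N.-homog.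
    by have := dhomogMn (2 ^ j) (X_homog i); rewrite mul1n.
  apply: (Khomog HK (dhomogM hx (mon_homog m))); apply/eqP => e2.
  apply: (@pow2_succ_neq s t r j t0).
  have E2 : (2 ^ j + mdeg m = 1 + (mdeg m).*2)%N by rewrite e2 e.
  have E3 : (1 + (mdeg m).*2 + 3 = 2 ^ r.+1 * (2 ^ (s + t) + 2 ^ s + 1))%N by rewrite e levN.
  by move: E2 E3; rewrite expnS -mulnA; move: (2 ^ r * _)%N (2 ^ j)%N => x y; lia.
- by rewrite mp_sqrD mulrDr; apply: (K_add0 HK).
Qed.

(** Two sets of size 3 among five indices meet in 1, 2 or 3 elements. Three rows guarantee that the
    number in [e1] is even, which the case of one common element uses. *)
Lemma swap5 r : @rows_commute 5 3 N r.+3.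
Proof.
move=> K HK I J h I3 J3.
have le3 : (#|I :&: J| <= 3)%N by have := subset_leq_card (subsetIl I J); rewrite I3.
have ge1 : (0 < #|I :&: J|)%N.
  have := subset_leq_card (subsetT (I :|: J)); rewrite cardsT card_ord cardsU I3 J3; lia.
have [c3|c3] := eqVneq #|I :&: J| 3%N.
  suff -> : I = J by [].
  have /setIidPl IJ : I :&: J = I by apply/eqP; rewrite eqEcard subsetIl c3 I3.
  by apply/eqP; rewrite eqEcard IJ I3 J3.
have [c2|c2] := eqVneq #|I :&: J| 2%N.
  by apply: (swap_adj low_vanish3 h HK I3 J3); rewrite c2.
have c1 : #|I :&: J| = 1%N by lia.
have z5 g : K (xprod setT * g ^+ 4) = 0; last first.
  exact: (@swap_meet1 N (@low_vanish3) K r.+1 I J h HK z5 I3 J3 c1).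
apply: (K_full_pow4 _ HK (@low_vanish3 _)); first 1 last.
- by rewrite odd_row_degree.
- by rewrite /=; lia.
move=> p q e e5 e3; have e1 : (2 ^ p + 2 ^ q + 1 = 2 ^ r.+1 * (2 ^ (s + t) + 2 ^ s + 1))%N.
  have E3 : (5 + e * 4 + 3 = 2 ^ r.+3 * (2 ^ (s + t) + 2 ^ s + 1))%N by rewrite e5 levN.
  by move: E3 e3; rewrite -e5 !expnS -!mulnA; lia.
(* By parity exactly one of [2 ^ p] and [2 ^ q] is 1; halving [e1] then leads back to
   [pow2_succ_neq]. *)
have {e5 e3} : ((p == 0) (+) (q == 0))%N.
  move: (congr1 odd e1); rewrite oddM oddX /= !oddD !oddX /=.
  by case: (p); case: (q).
have key q' : (2 ^ 0 + 2 ^ q'.+1 + 1 <> 2 ^ r.+1 * (2 ^ (s + t) + 2 ^ s + 1))%N.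
  move=> e'; apply: (@pow2_succ_neq s t r q' t0); move: e'; rewrite !expnS expn0; lia.
case: p e1 => [|p] e1; case: q e1 => [|q] e1 //= _; first exact: key e1.
by apply: (key p); rewrite -e1 [X in (X + 1)%N]addnC.
Qed.

End Arith3.

(** * Row relations as functions on the points of a Grassmannian *)

(* Sets of words, stored as trees for fast membership tests. *)
Inductive trie := Node of bool & seq trie.
Definition tnil := Node false [::].

Fixpoint tmem (t : trie) (s : seq nat) : bool :=
  let: Node b ch := t in if s is x :: s' then tmem (nth tnil ch x) s' else b.

Fixpoint tadd (t : trie) (s : seq nat) : trie :=
  let: Node b ch := t in
  if s is x :: s' then Node b (set_nth tnil ch x (tadd (nth tnil ch x) s'))
  else Node true ch.

Lemma tmem_nil s : tmem tnil s = false.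
Proof. by elim: s => //= x s IH; rewrite nth_nil. Qed.

Lemma tmem_tadd t s s' : tmem (tadd t s) s' -> s' = s \/ tmem t s'.
Proof.
elim: s t s' => [|x s IH] [b ch] [|x' s'] /=; try by [left | right].
rewrite nth_set_nth /=; case: eqP => [->|_]; last by right.
by move=> /IH [->|]; [left | right].
Qed.

Fixpoint subs (w : nat) (s : seq nat) : seq (seq nat) :=
  if s is x :: s' then
    (if w is w'.+1 then map (cons x) (subs w' s') else [::]) ++ subs w s'
  else if w is 0 then [:: [::]] else [::].

Lemma subsP w s u : u \in subs w s -> subseq u s /\ size u = w.
Proof.
elim: s w u => [|x s IH] [|w] u //=; first by rewrite inE => /eqP ->.
  by move=> /IH [su ->]; split=> //; apply: subseq_trans su (subseq_cons _ _).
rewrite mem_cat => /orP[/mapP [v /IH [sv sz] ->]|/IH [su ->]]; first by rewrite /= eqxx sz.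
by split=> //; apply: subseq_trans su (subseq_cons _ _).
Qed.

(** Multisets, each represented by its nondecreasing word. *)
Fixpoint msets (D m : nat) : seq (seq nat) :=
  if D is D'.+1 then
    [seq x :: t | x <- iota 0 m, t <- [seq t <- msets D' m | path leq x t]]
  else [:: [::]].

Lemma mem_msets D m T : size T = D -> all (ltn^~ m) T -> sorted leq T -> T \in msets D m.
Proof.
elim: D T => [|D IH] [|x T] //= [sT] /andP[xm Tm] pT.
apply/allpairsPdep; exists x, T; split=> //=; first by rewrite mem_iota.
by rewrite mem_filter pT IH //; apply: path_sorted pT.
Qed.

Lemma msetsP D m T : T \in msets D m -> size T = D /\ all (ltn^~ m) T.
Proof.
elim: D T => [|D IH] T /=; first by rewrite inE => /eqP ->.
move/allpairsPdep => [x [t [xm]]]; rewrite mem_filter => /andP[_ /IH [st tm]] ->.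
by rewrite /= st tm andbT; split=> //; move: xm; rewrite mem_iota.
Qed.

Fixpoint bools (n : nat) : seq (seq bool) :=
  if n is n'.+1 then map (cons false) (bools n') ++ map (cons true) (bools n')
  else [:: [::]].

Definition unitv (n i : nat) : seq bool := mkseq (fun j => j == i) n.

(* The [w * k] matrices over F_2 of rank [w] in reduced row echelon form, stored by columns;
   [r] counts the pivots already placed. *)
Fixpoint rref (w k r : nat) : seq (seq (seq bool)) :=
  if k is k'.+1 then
    (if (r < w)%N then map (cons (unitv w r)) (rref w k' r.+1) else [::]) ++
    flatten [seq map (cons (v ++ nseq (w - r)%N false)) (rref w k' r) | v <- bools r]
  else if r == w then [:: [::]] else [::].

(** Laplace expansion without signs: over F_2 the permanent is the determinant. *)
Fixpoint permb (cols : seq (seq bool)) (J : seq nat) : bool :=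
  if cols is c :: cs then
    foldr (fun j b => (nth false c j && permb cs (rem j J)) (+) b) false J
  else true.

Definition submatrix_det (w : nat) (A : seq (seq bool)) (I : seq nat) : bool :=
  permb [seq nth [::] A i | i <- I] (iota 0 w).

Definition xorv (u v : seq bool) : seq bool := [seq x.1 (+) x.2 | x <- zip u v].

(** One Gauss-Jordan step at column [i]; the first component collects the pivot rows. The pivot row
    also stays in the second component, where adding it to itself makes it zero. *)
Definition gstep (st : seq (seq bool) * seq (seq bool)) (i : nat) :=
  if [seq r <- st.2 | nth false r i] is p :: _ then
    let f r := if nth false r i then xorv p r else r in
    (rcons (map f st.1) p, map f st.2)
  else st.

Definition gauss (n : nat) (rs : seq (seq bool)) :=
  (foldl gstep ([::], rs) (iota 0 n)).1.

Lemma gauss_inv (Q : seq bool -> Prop) n rs :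
  (forall u v, Q u -> Q v -> Q (xorv u v)) ->
  (forall u, u \in rs -> Q u) -> forall u, u \in gauss n rs -> Q u.
Proof.
move=> Qx; rewrite /gauss; set st := ([::], rs) => Qrs.
have: (forall u, u \in st.1 -> Q u) /\ (forall u, u \in st.2 -> Q u) by split.
elim: (iota 0 n) st => [|i s IH] st [Q1 Q2] //=; apply: IH.
rewrite /gstep; case E: [seq r <- st.2 | nth false r i] => [|p ps] //=.
have Qp : Q p.
  have : p \in [seq r <- st.2 | nth false r i] by rewrite E mem_head.
  by rewrite mem_filter => /andP[_ /Q2].
have Qf r : Q r -> Q (if nth false r i then xorv p r else r).
  by case: ifP => _ // /(Qx _ _ Qp).
split=> u; last by case/mapP => r /Q2 /Qf ? ->.
by rewrite mem_rcons inE => /orP[/eqP -> //|/mapP [r /Q1 /Qf ? ->]].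
Qed.

(* If a function vanishes on all words of the relation [r] but one, it vanishes on that one. *)
Definition peel1 (K : trie) (r : seq (seq nat)) : trie :=
  if [seq u <- r | ~~ tmem K u] is [:: u] then tadd K u else K.

Section Level.
Variables k w D : nat.

(* A row of size [w] is encoded by its index in [labs], a block of rows by the list of the indices. *)
Definition labs := subs w (iota 0 k).
Definition lab (I : seq nat) : nat := index (sort leq I) labs.
Definition pts := rref w k 0.

Definition relgen (f : seq nat -> seq nat -> nat -> seq nat) : seq (seq (seq nat)) :=
  [seq [seq f L A i | i <- [seq i <- L | i \notin A]]
     | L <- subs w.+1 (iota 0 k), A <- subs w.-1 (iota 0 k)].
Definition quads := relgen (fun I A i => [:: lab (rem i I); lab (i :: A)]).
Definition cubs := relgen (fun I A i => [:: lab (rem i I); lab (rem i I); lab (i :: A)]).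

Definition rels : seq (seq (seq nat)) :=
  [seq [seq sort leq (u ++ t) | u <- q] | q <- quads, t <- msets (D - 2)%N (size labs)] ++
  [seq [seq sort leq (u ++ t) | u <- q] | q <- cubs, t <- msets (D - 3)%N (size labs)].

Definition peeled n (B : seq (seq nat)) : trie :=
  iter n (fun K => foldl peel1 K rels) (foldl tadd tnil B).

Definition minor (A : seq (seq bool)) (l : nat) : bool := submatrix_det w A (nth [::] labs l).
Definition minor_table : seq (seq bool) := [seq [seq minor A l | l <- iota 0 (size labs)] | A <- pts].
Definition evt (dt : seq (seq bool)) (T : seq nat) : seq bool :=
  [seq all (nth false dr) T | dr <- dt].

(** Both the values of a functional on blocks of [D] rows and the products of minors at a point
    satisfy these relations; [localize] expresses the former through the latter. *)
Record row_relfun (c : seq nat -> 'F_2) : Prop := RelFun {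
  rel_perm : forall T T', size T = D -> all (ltn^~ (size labs)) T -> perm_eq T T' -> c T = c T';
  rel_quad : forall q T, q \in quads -> size T = (D - 2)%N -> all (ltn^~ (size labs)) T ->
    \sum_(u <- q) c (u ++ T) = 0;
  rel_cub : forall q T, q \in cubs -> size T = (D - 3)%N -> all (ltn^~ (size labs)) T ->
    \sum_(u <- q) c (u ++ T) = 0 }.

Definition labs_ok := all (all (all (ltn^~ (size labs)))) (quads ++ cubs).

Hypothesis D3 : (2 < D)%N.
Hypothesis lok : labs_ok.

Lemma rel_sort c r : row_relfun c -> r \in rels -> \sum_(u <- r) c u = 0.
Proof.
move=> [cp cq cc]; rewrite mem_cat => /orP[]/allpairsP[[q t] /= [qq /msetsP [st tm] ->]];
  rewrite big_map.
  rewrite -[RHS](cq q t qq st tm) big_seq [RHS]big_seq; apply: eq_bigr => u uq.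
  have := allP lok q; rewrite mem_cat qq /= => /(_ isT) /allP /(_ u uq) um.
  symmetry; apply: cp; last by rewrite perm_sym perm_sort.
    have su : size u = 2%N by move/allpairsP: qq => [[I A] [_ _ /= eq]]; move: uq; rewrite eq => /mapP [i _ ->].
    by rewrite size_cat st su subnKC // ltnW.
  by rewrite all_cat um.
rewrite -[RHS](cc q t qq st tm) big_seq [RHS]big_seq; apply: eq_bigr => u uq.
have := allP lok q; rewrite mem_cat qq orbT => /(_ isT) /allP /(_ u uq) um.
symmetry; apply: cp; last by rewrite perm_sym perm_sort.
  have su : size u = 3%N by move/allpairsP: qq => [[I A] [_ _ /= eq]]; move: uq; rewrite eq => /mapP [i _ ->].
  by rewrite size_cat st su subnKC // ltnW.
by rewrite all_cat um.
Qed.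

Lemma peel1_sound c K r : \sum_(u <- r) c u = 0 :> 'F_2 ->
  (forall T, tmem K T -> c T = 0) -> forall T, tmem (peel1 K r) T -> c T = 0.
Proof.
move=> r0 cK T; rewrite /peel1.
case E: [seq u <- r | ~~ tmem K u] => [|u [|]]; try exact: cK.
case/tmem_tadd => [->|]; last exact: cK.
rewrite -[RHS]r0 (bigID (fun u => ~~ tmem K u)) /= -[X in X + _]big_filter E big_seq1.
rewrite [X in _ + X]big1 ?addr0 // => v; rewrite negbK; exact: cK.
Qed.

Lemma peeled_sound c n B : row_relfun c -> (forall b, b \in B -> c b = 0) ->
  forall T, tmem (peeled n B) T -> c T = 0.
Proof.
move=> rc cB; rewrite /peeled.
have : forall T, tmem (foldl tadd tnil B) T -> c T = 0.
  have : forall T, tmem tnil T -> c T = 0 by move=> T; rewrite tmem_nil.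
  elim: B (tnil) cB => [|b B IH] K cB cK //=; apply: IH => [b' b'B|T].
    by apply: cB; rewrite inE b'B orbT.
  by case/tmem_tadd => [->|/cK //]; apply: cB; rewrite mem_head.
elim: n (foldl _ _ _) => [|n IH] K cK //=.
have : forall r, r \in rels -> \sum_(u <- r) c u = 0 by move=> r; apply: rel_sort.
elim: rels (iter _ _ _) (IH _ cK) => [|r rs IHr] K' cK' rs0 //=; apply: IHr.
  by apply: peel1_sound => //; apply: rs0; rewrite mem_head.
by move=> r' r'rs; apply: rs0; rewrite inE r'rs orbT.
Qed.

Variables (passes : nat) (B : seq (seq nat)).

(* [B] is meant to be a set of as many words as there are points, from which all words of length
   [D] are reached by [peel1]. *)
Definition peel_ok := let K := peeled passes B in all (tmem K) (msets D (size labs)).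

(** A solution of the relations is determined by its values on [B], which bounds the dimension of
    the solution space by the size of [B]. *)
Lemma row_relfun0 c : peel_ok -> row_relfun c -> (forall b, b \in B -> c b = 0) ->
  forall T, size T = D -> all (ltn^~ (size labs)) T -> c T = 0.
Proof.
move=> ok rc cB T sT Tm; have pT : perm_eq T (sort leq T) by rewrite perm_sym perm_sort.
rewrite (rel_perm rc sT Tm pT); apply: (peeled_sound (n := passes) rc cB).
apply: (allP ok); apply: mem_msets; rewrite ?size_sort ?all_sort //.
exact: sort_sorted leq_total _.
Qed.

Let n := size pts.
Definition minor_at (W l : nat) : bool := minor (nth [::] pts W) l.

Definition minors_ok := all (fun dr => all (fun q => ~~ odd (count (all (nth false dr)) q))
   (quads ++ cubs)) minor_table.

Lemma nth_minor_table W l : (W < n)%N -> (l < size labs)%N ->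
  nth false (nth [::] minor_table W) l = minor_at W l.
Proof. by move=> hW hl; rewrite (nth_map [::]) // (nth_map 0%N) ?size_iota // nth_iota. Qed.

Lemma all_minor_table W T : (W < n)%N -> all (ltn^~ (size labs)) T ->
  all (nth false (nth [::] minor_table W)) T = all (minor_at W) T.
Proof. by move=> hW /allP hT; apply: eq_in_all => l /hT hl; rewrite nth_minor_table. Qed.

Lemma minor_rel W q T : minors_ok -> (W < n)%N -> q \in quads ++ cubs ->
  \sum_(u <- q) (all (minor_at W) (u ++ T))%:R = 0 :> 'F_2.
Proof.
move=> ok hW hq; under eq_bigr => u _ do rewrite all_cat -mulnb natrM.
rewrite -mulr_suml; suff -> : \sum_(u <- q) (all (minor_at W) u)%:R = 0 :> 'F_2 by rewrite mul0r.
have hd : nth [::] minor_table W \in minor_table by rewrite mem_nth // size_map.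
have := allP (allP ok _ hd) _ hq; rewrite -natr_sum F2_natr.
suff -> : count (all (nth false (nth [::] minor_table W))) q = (\sum_(u <- q) all (minor_at W) u)%N.
  by move/negbTE => ->.
rewrite -sum1_count big_mkcond /= big_seq [RHS]big_seq; apply: eq_bigr => u uq.
by rewrite (all_minor_table hW (allP (allP lok q hq) u uq)); case: (all _ _).
Qed.

Lemma row_relfun_minor W : minors_ok -> (W < n)%N -> row_relfun (fun T => (all (minor_at W) T)%:R).
Proof.
move=> ok hW; split=> [T T' _ _ pT|q T hq _ _|q T hq _ _].
- by rewrite (perm_all _ pT).
- by apply: minor_rel; rewrite ?mem_cat ?hq.
- by apply: minor_rel; rewrite ?mem_cat ?hq ?orbT.
Qed.

Lemma row_relfunD c c' : row_relfun c -> row_relfun c' -> row_relfun (fun T => c T + c' T).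
Proof.
move=> [cp cq cc] [cp' cq' cc']; split=> [T T' sT Tm pT|q T hq sT Tm|q T hq sT Tm].
- by rewrite (cp _ _ sT Tm pT) (cp' _ _ sT Tm pT).
- by rewrite big_split /= cq // cq' // addr0.
- by rewrite big_split /= cc // cc' // addr0.
Qed.

Lemma row_relfunZ x c : row_relfun c -> row_relfun (fun T => c T * x).
Proof.
move=> [cp cq cc]; split=> [T T' sT Tm pT|q T hq sT Tm|q T hq sT Tm].
- by rewrite (cp _ _ sT Tm pT).
- by rewrite -mulr_suml cq // mul0r.
- by rewrite -mulr_suml cc // mul0r.
Qed.

Lemma row_relfun_0 : row_relfun (fun=> 0).
Proof. by split=> // *; rewrite big1. Qed.

Lemma eq_row_relfun c c' : c =1 c' -> row_relfun c -> row_relfun c'.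
Proof.
move=> e [cp cq cc]; split=> [T T' sT Tm pT|q T hq sT Tm|q T hq sT Tm].
- by rewrite -!e (cp _ _ sT Tm pT).
- by rewrite -[RHS](cq q T hq sT Tm); apply: eq_bigr => u _; rewrite e.
- by rewrite -[RHS](cc q T hq sT Tm); apply: eq_bigr => u _; rewrite e.
Qed.

Lemma row_relfun_sum (J : Type) (r : seq J) (c : J -> seq nat -> 'F_2) :
  (forall j, row_relfun (c j)) -> row_relfun (fun T => \sum_(j <- r) c j T).
Proof.
move=> hc; elim: r => [|j r IH].
  by apply: eq_row_relfun row_relfun_0 => T; rewrite big_nil.
by apply: eq_row_relfun (row_relfunD (hc j) IH) => T; rewrite big_cons.
Qed.

Variable inv : seq (seq bool).

(** [inv] is checked to be a left inverse of the matrix of values of the points on the words in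
    [B]. *)
Definition inverse_ok :=
  [&& size B == n, all (fun b => (size b == D) && all (ltn^~ (size labs)) b) B &
  let evs := [seq [seq all (nth false dr) b | b <- B] | dr <- minor_table] in
  all (fun W => let r := nth [::] inv W in (size r == n) &&
    all (fun W' => odd (count (fun x => x.1 && x.2) (zip r (nth [::] evs W'))) == (W == W'))
      (iota 0 n)) (iota 0 n)].

Hypothesis iok : inverse_ok.

Let iv (W j : nat) : 'F_2 := (nth false (nth [::] inv W) j)%:R.

Lemma inverseP W W' : (W < n)%N -> (W' < n)%N ->
  \sum_(j < n) iv W j * (all (minor_at W') (nth [::] B j))%:R = (W == W')%:R.
Proof.
move=> hW hW'; case/and3P: iok => /eqP sB /allP hB hE.
have /andP[/eqP sr hr] := allP hE W (etrans (mem_iota 0 n W) hW).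
have /eqP <- := allP hr W' (etrans (mem_iota 0 n W') hW').
rewrite -F2_natr -sum1_count natr_sum [RHS]big_mkcond (big_nth (false, false)) big_mkord.
have se : size (nth [::] [seq [seq all (nth false dr) b | b <- B] | dr <- minor_table] W') = n.
  by rewrite (nth_map [::]) ?size_map.
rewrite size_zip sr se minnn; apply: eq_bigr => j _.
rewrite nth_zip ?sr ?se //= (nth_map [::]) ?size_map // (nth_map [::]) ?sB //.
have jB : (j < size B)%N by rewrite sB.
have /andP[_ bm] := hB _ (mem_nth [::] jB).
rewrite all_minor_table //.
by rewrite /iv; case: (nth false _ _); case: all; rewrite ?mul0r ?mulr0 ?mulr1.
Qed.

Definition acoef (c : seq nat -> 'F_2) W := \sum_(j < n) iv W j * c (nth [::] B j).

(** Both sides satisfy the relations, so agreement on [B] suffices. There it says that [inv] is also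
    a right inverse, which follows because the matrix is square. *)
Lemma localize c : peel_ok -> minors_ok -> row_relfun c ->
  forall T, size T = D -> all (ltn^~ (size labs)) T ->
  c T = \sum_(W < n) (all (minor_at W) T)%:R * acoef c W.
Proof.
move=> pok dok rc T sT Tm; apply: F2_add_eq0.
pose c' T := c T + \sum_(W < n) (all (minor_at W) T)%:R * acoef c W.
apply: (@row_relfun0 c') => //.
  apply: row_relfunD => //; apply: row_relfun_sum => W; apply: row_relfunZ.
  exact: row_relfun_minor.
case/and3P: iok => /eqP sB _ _ b bB; rewrite /c'.
have {bB} hj : (index b B < n)%N by rewrite -sB index_mem.
rewrite -(nth_index [::] (_ : b \in B)) -?index_mem ?sB //.
set j0 := Ordinal hj; rewrite -[index b B]/(val j0).
pose X := \matrix_(W < n, j < n) iv W j.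
pose M := \matrix_(j < n, W < n) ((all (minor_at W) (nth [::] B j))%:R : 'F_2).
have /mulmx1C MX : X *m M = 1%:M.
  apply/matrixP => W W'; rewrite !mxE; apply: etrans (inverseP (ltn_ord W) (ltn_ord W')).
  by apply: eq_bigr => j _; rewrite !mxE.
suff -> : \sum_(W < n) (all (minor_at W) (nth [::] B j0))%:R * acoef c W = c (nth [::] B j0).
  by rewrite F2_addxx.
under eq_bigr => W _ do rewrite /acoef mulr_sumr.
rewrite exchange_big /= (bigD1 j0) //= [X in _ + X]big1 ?addr0 => [|j ne].
  under eq_bigr => W _ do rewrite mulrA.
  rewrite -mulr_suml; have := congr1 (fun Z : 'M_n => Z j0 j0) MX; rewrite !mxE eqxx => E.
  rewrite (_ : \sum_(W < n) _ = 1) ?mul1r //; rewrite -[RHS]E; apply: eq_bigr => W _.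
  by rewrite !mxE.
under eq_bigr => W _ do rewrite mulrA.
rewrite -mulr_suml; have := congr1 (fun Z : 'M_n => Z j0 j) MX; rewrite !mxE eq_sym (negbTE ne) => E.
rewrite (_ : \sum_(W < n) _ = 0) ?mul0r //; rewrite -[RHS]E; apply: eq_bigr => W _.
by rewrite !mxE.
Qed.

(* The coefficients of the linear form [sum_(i in I) Delta_(I - i)(W) x_i], which vanishes on [W]. *)
Definition xi (I : seq nat) (W i : nat) : bool := (i \in I) && minor_at W (lab (rem i I)).

(** Products of [D - 1] minors must give all functions on the points where the form [xi I W] is
    nonzero: together with the indicators of the other points they reduce to the standard basis. *)
Definition sep_ok :=
  let evs := [seq evt minor_table T | T <- msets D.-1 (size labs)] in
  let units := [seq unitv n W | W <- iota 0 n] in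
  all (fun I => gauss n (evs ++ [seq unitv n W | W <- iota 0 n & all (fun i => ~~ xi I W i) I])
         == units) (subs w.+1 (iota 0 k)).

(** [G] is orthogonal to a spanning set of functions on the points, hence zero; orthogonality is
    closed under addition and so survives [gauss]. *)
Lemma separate (G : nat -> 'F_2) I : sep_ok -> I \in subs w.+1 (iota 0 k) ->
  (forall T, size T = D.-1 -> all (ltn^~ (size labs)) T ->
     \sum_(W < n) (all (minor_at W) T)%:R * G W = 0) ->
  (forall W, (W < n)%N -> (forall i, i \in I -> ~~ xi I W i) -> G W = 0) ->
  forall W, (W < n)%N -> G W = 0.
Proof.
move=> ok hI hT hz W hW.
pose Q (v : seq bool) := size v = n /\ \sum_(W < n) (nth false v W)%:R * G W = 0.
have Qu : Q (unitv n W) -> G W = 0.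
  case=> _; rewrite (bigD1 (Ordinal hW)) //= big1 ?addr0 => [|W' ne].
    by rewrite nth_mkseq // eqxx mul1r.
  by rewrite nth_mkseq // -val_eqE in ne *; rewrite (negbTE ne) mul0r.
have hu : unitv n W \in [seq unitv n W | W <- iota 0 n] by apply: map_f; rewrite mem_iota.
have /eqP eg := allP ok I hI; rewrite -eg in hu.
apply: Qu; move: hu; apply: gauss_inv; last first.
- move=> u; rewrite mem_cat => /orP[/mapP [T /msetsP [sT Tm] ->]|/mapP [W' + ->]].
    split; first by rewrite !size_map.
    rewrite -[RHS](hT T sT Tm); apply: eq_bigr => W' _; congr (_%:R * _).
    by rewrite (nth_map [::]) ?size_map // all_minor_table.
  rewrite mem_filter mem_iota => /andP[/allP hx /= hW']; split; first by rewrite size_mkseq.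
  rewrite big1 // => W2 _; rewrite nth_mkseq //; case: eqP => [->|]; last by rewrite mul0r.
  by rewrite hz ?mulr0.
- move=> u v [su Eu] [sv Ev]; split; first by rewrite size_map size_zip su sv minnn.
  transitivity (\sum_(W < n) (nth false u W)%:R * G W + \sum_(W < n) (nth false v W)%:R * G W);
    last by rewrite Eu Ev addr0.
  rewrite -big_split /=; apply: eq_bigr => W' _.
  rewrite /xorv (nth_map (false, false)) ?size_zip ?su ?sv ?minnn // nth_zip ?su ?sv //=.
  by rewrite -mulrDl; congr (_ * _); case: nth; case: nth; rewrite ?addr0 ?add0r ?F2_addxx.
Qed.

End Level.

(* The points are in echelon form, so [piv w A j] is the column that equals the unit vector [j]. *)
Definition piv (w : nat) (A : seq (seq bool)) (j : nat) : nat := index (unitv w j) A.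

(* The coefficients of [x_i] plus its restriction to the point [A], read in the pivot variables. *)
Definition xipiv (k w : nat) (A : seq (seq bool)) (i : nat) : seq bool :=
  mkseq (fun i' => (i' == i) (+)
    odd (count (fun j => nth false (nth [::] A i) j && (i' == piv w A j)) (iota 0 w))) k.

(** The forms [xipiv] generate the ideal of the subspace. Each nonzero one has to be some [xi I W],
    a form for which a relation is available. *)
Definition pts_ok (k w : nat) :=
  all (fun W => let A := nth [::] (pts k w) W in
    [&& size A == k, all (fun c => size c == w) A,
        all (fun j => piv w A j < k)%N (iota 0 w) &
        all (fun i => (xipiv k w A i == nseq k false) ||
          has (fun I => xipiv k w A i == mkseq (xi k w I W) k) (subs w.+1 (iota 0 k)))
        (iota 0 k)]) (iota 0 (size (pts k w))).

(** Gauss-Jordan elimination of the evaluation matrix augmented by the identity; the outcome is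
    verified by [inverse_ok]. *)
Definition inverse (k w : nat) (B : seq (seq nat)) : seq (seq bool) :=
  let n := size (pts k w) in let dt := minor_table k w in
  [seq drop n r | r <- gauss n [seq evt dt (nth [::] B j) ++ unitv n j | j <- iota 0 n]].

Definition certificate (k w D passes : nat) (B : seq (seq nat)) (inv : seq (seq bool)) :=
  [/\ labs_ok k w, peel_ok k w D passes B, minors_ok k w, inverse_ok k w D B inv &
   sep_ok k w D /\ pts_ok k w].

(** * Computed certificates for the three levels *)

Fixpoint digits n (x : N) : seq nat :=
  if n is n'.+1 then
    rcons (digits n' (N.div x 10%num)) (N.to_nat (N.modulo x 10%num))
  else [::].

(* The decimal digits are the indices of the rows; both this list and the number of passes needed
   by [peeled] were found by a randomized search. *)
Definition basis53 : seq (seq nat) := map (digits 5) [::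
  11225; 2567; 3499; 22333; 227; 24447; 11299; 77779; 4568; 45555; 117; 1123; 12899; 245;
  23356; 15668; 66; 33445; 14479; 45577; 1888; 22335; 2366; 448; 4599; 46899; 1149; 23458;
  56799; 1155; 47999; 33359; 388; 13578; 11669; 2577; 2259; 1448; 67778; 11278; 248; 58899;
  15556; 166; 4779; 25789; 678; 23448; 34444; 14577; 13499; 3355; 4589; 156; 17788; 25679;
  558; 4699; 18889; 26667; 11149; 2578; 11113; 23444; 34566; 24489; 23679; 668; 11367; 3479;
  2233; 13366; 45778; 3369; 34; 24488; 55555; 25899; 47777; 28; 22229; 34699; 27788; 57799;
  11122; 999; 1258; 3678; 34667; 35666; 6667; 4477; 113; 2799; 13339; 22779; 89999; 35667;
  99999; 22777; 33449; 66899; 36669; 3446; 56689; 78999; 44599; 11111; 69999; 33555; 66789;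
  12888; 35888; 25558; 2244; 88888; 11355; 11666; 33568; 15588; 68888; 4; 1278; 22445; 11115;
  2; 12258; 3336; 22555; 7; 3; 28888; 34459; 44444; 1145; 2447; 22444; 33333; 78888; 67779;
  1122; 136; 33999; 16668; 77777; 44499; 67777; 55558; 11; 11118; 33366; 0; 66666; 22222;
  59999]%num.

(** Leading zeros count: here the number 1 is the word 0, 0, 0, 1. The 7 words match the planes in
    F_2^3, and the 3 words of [basis21] the lines in F_2^2. *)
Definition basis32 : seq (seq nat) := map (digits 4) [:: 0; 1111; 2222; 1; 2; 1112; 12]%num.
Definition basis21 : seq (seq nat) := map (digits 3) [:: 0; 111; 1]%num.

Lemma cert21 : certificate 2 1 3 9 basis21 (inverse 2 1 basis21).
Proof. by []. Qed.

Lemma cert32 : certificate 3 2 4 9 basis32 (inverse 3 2 basis32).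
Proof. by []. Qed.

Lemma labs53 : labs_ok 5 3.
Proof. by vm_compute. Qed.

Lemma peel53 : peel_ok 5 3 5 9 basis53.
Proof. by vm_compute. Qed.

Lemma minors53 : minors_ok 5 3.
Proof. by vm_compute. Qed.

Lemma inverse53 : inverse_ok 5 3 5 basis53 (inverse 5 3 basis53).
Proof. by vm_compute. Qed.

Lemma sep53 : sep_ok 5 3 5.
Proof. by vm_compute. Qed.

Lemma pts_ok53 : pts_ok 5 3.
Proof. by vm_compute. Qed.

Lemma cert53 : certificate 5 3 5 9 basis53 (inverse 5 3 basis53).
Proof.
exact: And5 labs53 peel53 minors53 inverse53 (conj sep53 pts_ok53).
Qed.

(** * Index sets as lists, and minors as values of Kameko's map *)

Definition sset k (X : seq nat) : {set 'I_k} := [set i : 'I_k | val i \in X].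

Lemma big_sset (V : Type) (idx : V) (op : Monoid.com_law idx) k (X : seq nat) (F : nat -> V) :
  uniq X -> all (ltn^~ k) X ->
  \big[op/idx]_(i in sset k X) F i = \big[op/idx]_(i <- X) F i.
Proof.
move=> uX /allP lX; under eq_bigl => i do rewrite inE.
rewrite -(big_mkord (fun i => i \in X) F) -big_filter; apply: perm_big.
apply: uniq_perm => //; first by rewrite filter_uniq // iota_uniq.
by move=> i; rewrite mem_filter mem_index_iota /=; case: (boolP (i \in X)) => //= /lX.
Qed.

Lemma card_sset k X : uniq X -> all (ltn^~ k) X -> #|sset k X| = size X.
Proof. by move=> uX lX; rewrite -sum1_card (big_sset _ (fun=> 1%N)) // sum1_size. Qed.

Lemma sset_rem k X (i : 'I_k) : uniq X -> sset k (rem (val i) X) = sset k X :\ i.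
Proof. by move=> uX; apply/setP => j; rewrite !inE mem_rem_uniq // inE. Qed.

Lemma sset_cons k X (i : 'I_k) : sset k (val i :: X) = i |: sset k X.
Proof. by apply/setP => j; rewrite !inE. Qed.

Lemma sset_sort k X : sset k (sort leq X) = sset k X.
Proof. by apply/setP => j; rewrite !inE mem_sort. Qed.

Lemma foldr_addb (R : nzRingType) (F : nat -> bool) (s : seq nat) : 1 + 1 = 0 :> R ->
  (foldr (fun j b => F j (+) b) false s)%:R = \sum_(j <- s) (F j)%:R :> R.
Proof.
move=> R2; elim: s => [|j s IH]; first by rewrite big_nil.
by rewrite big_cons -IH /=; case: (F j); case: foldr; rewrite ?addr0 ?add0r.
Qed.

Section Perm.
Variable w : nat.
Implicit Types (J : seq nat) (c : seq bool) (cs : seq (seq bool)).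

Definition lin c : P w := \sum_(j < w | nth false c j) 'X_j.

Lemma lin_homog c : lin c \is 1.-homog.
Proof. by apply: rpred_sum => j _; apply: X_homog. Qed.

Lemma phi_low d (f : P w) : f \is d.-homog -> (d < w)%N -> phi f = 0.
Proof.
move=> hf dw; apply/mpolyP => m; rewrite mcoeff_phi mcoeff0.
apply: (dhomog_nemf_coeff hf); apply/eqP => e; have {}e : mdeg (upm m) = d := e.
suff E : mdeg (upm m) = (w + (mdeg m).*2)%N by move: dw; rewrite -e E; lia.
rewrite !mdegE; transitivity (\sum_(i < w) 1 + (\sum_(i < w) m i).*2)%N; last first.
  by rewrite sum1_card card_ord.
rewrite -muln2 big_distrl /= -big_split /=.
by apply: eq_bigr => i _; rewrite mnmE muln2.
Qed.

Lemma linprod_homog cs : \prod_(c <- cs) lin c \is (size cs).-homog.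
Proof.
elim: cs => [|c cs IH]; first by rewrite big_nil; exact: dhomog1.
by rewrite big_cons -[size _]/(1 + size cs)%N; apply: dhomogM => //; apply: lin_homog.
Qed.

(* Multiplying by the variables outside [J] turns [phi] into the extraction of the coefficient of
   the variables in [J], so this is the expansion of a determinant along its first row. *)
Lemma phi_linprod cs J : uniq J -> all (ltn^~ w) J -> size cs = size J ->
  phi (\prod_(c <- cs) lin c * xprod (~: sset w J)) = (permb cs J)%:R.
Proof.
elim: cs J => [|c cs IH] J uJ lJ sJ.
  rewrite (size0nil (esym sJ)) big_nil mul1r /= phi_xprod.
  suff -> : ~: sset w [::] = setT by rewrite eqxx.
  by apply/setP => i; rewrite !inE.
rewrite big_cons /lin mulr_suml mulr_suml.
have phis (I : Type) (r : seq I) (p : pred I) (F : I -> P w) :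
    phi (\sum_(i <- r | p i) F i) = \sum_(i <- r | p i) phi (F i).
  by elim/big_rec2: _ => [|i x y _ <-]; rewrite ?phi0 ?phiD.
rewrite phis /=.
rewrite (foldr_addb (fun j => nth false c j && permb cs (rem j J)) _ (mp_addxx 1)).
rewrite -(big_sset _ (fun j => (nth false c j && permb cs (rem j J))%:R : P w) uJ lJ).
rewrite big_mkcond [RHS]big_mkcond; apply: eq_bigr => j _.
rewrite inE; case: ifP => cj; last by case: ifP.
case: ifP => jJ /=.
  rewrite -IH ?rem_uniq ?size_rem //; last 2 first.
  - by apply/allP => i /mem_rem /(allP lJ).
  - by rewrite -sJ.
  congr (phi _); rewrite ['X_j * _]mulrC -mulrA; congr (_ * _).
  have -> : ~: sset w (rem (val j) J) = j |: ~: sset w J.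
    by rewrite sset_rem // setCD setUC.
  by rewrite xprodU1 // !inE negbK.
have jC : j \in ~: sset w J by rewrite !inE jJ.
rewrite (xprodD1 jC) mulrACA -expr2 mulrC phi_sqr.
rewrite (phi_low (dhomogM (linprod_homog cs) (xprod_homog _))) ?mul0r //.
have := cardsD1 j (~: sset w J); have := cardsC (sset w J).
rewrite card_ord (card_sset uJ lJ) -sJ jC /= add1n => e1 e2.
by rewrite -[X in (_ < X)%N]e1 e2 addSnnS ltn_add2l.
Qed.

End Perm.

(** * Restriction to a subspace and its section *)

Section Points.
Variables (k w : nat) (A : seq (seq bool)).

(** The rows of the matrix [A] span the subspace; [pcol i] is the coordinate ['X_i] on it, written
    in the [w] parameters. *)
Definition pcol (i : 'I_k) : P w := lin w (nth [::] A i).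
Definition restr : P k -> P w := sub pcol.
(** The sum consists of the pivot variable of [j], or is empty if the pivot index is out of
    range. *)
Definition psec (j : 'I_w) : P k := \sum_(i < k | val i == piv w A j) 'X_i.
Definition sect : P w -> P k := sub psec.

Lemma restrD : {morph restr : f g / f + g}. Proof. exact: subD. Qed.
Lemma restrM : {morph restr : f g / f * g}. Proof. exact: subM. Qed.
Lemma sectD : {morph sect : f g / f + g}. Proof. exact: subD. Qed.
Lemma sectM : {morph sect : f g / f * g}. Proof. exact: subM. Qed.

Lemma pcol_homog i : pcol i \is 1.-homog. Proof. exact: lin_homog. Qed.

Lemma psec_homog j : psec j \is 1.-homog.
Proof. by apply: rpred_sum => i _; apply: X_homog. Qed.

Lemma restr_Sq f : restr (Sq f) = Sq (restr f).
Proof. by symmetry; apply: Sq_sub => i; apply: linform_sum. Qed.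

Lemma sect_Sq f : sect (Sq f) = Sq (sect f).
Proof. by symmetry; apply: Sq_sub => i; apply: linform_sum. Qed.

Lemma restr_homog d f : f \is d.-homog -> restr f \is d.-homog.
Proof. exact: sub_homog pcol_homog. Qed.

Lemma sect_homog d f : f \is d.-homog -> sect f \is d.-homog.
Proof. exact: sub_homog psec_homog. Qed.

Lemma restr_sect f : (forall j, (j < w)%N -> (piv w A j < k)%N) -> size A = k ->
  restr (sect f) = f.
Proof.
move=> pk sA; move: f; apply: mp_alg_ind => [||j|f g If Ig|f g If Ig].
- by rewrite /sect sub0 /restr sub0.
- by rewrite /sect sub1 /restr sub1.
- rewrite /sect subX /psec (big_pred1 (Ordinal (pk j (ltn_ord j)))); last first.
    by move=> i; rewrite /= -val_eqE.
  rewrite /restr subX /pcol /=; have -> : nth [::] A (piv w A j) = unitv w j.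
    by apply: nth_index; rewrite -index_mem sA; apply: pk.
  rewrite /lin (big_pred1 j) // => i; rewrite nth_mkseq //.
- by rewrite sectD restrD If Ig.
- by rewrite sectM restrM If Ig.
Qed.

(** [phi] reads off the coefficient of the product of all [w] parameters in a product of [w] linear
    forms, which over F_2 is a determinant. *)
Lemma phi_restr l : (l < size (labs k w))%N ->
  phi (restr (xprod (sset k (nth [::] (labs k w) l)))) = (minor k w A l)%:R.
Proof.
move=> hl; have [sX zX] := subsP (mem_nth [::] hl); set X := nth _ _ _ in sX zX *.
have uX : uniq X by apply: subseq_uniq sX (iota_uniq _ _).
have lX : all (ltn^~ k) X.
  by apply/allP => x /(mem_subseq sX); rewrite mem_iota.
rewrite /restr /xprod sub_prod; under eq_bigr => i _ do rewrite subX /pcol.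
rewrite (big_sset _ (fun i => lin w (nth [::] A i)) uX lX).
have := @phi_linprod w [seq nth [::] A i | i <- X] (iota 0 w) (iota_uniq _ _).
rewrite big_map size_map zX size_iota; have -> : ~: sset w (iota 0 w) = set0.
  by apply/setP => i; rewrite !inE mem_iota ltn_ord.
rewrite /xprod big_set0 mulr1; apply => //.
by apply/allP => x; rewrite mem_iota.
Qed.

Lemma phi_restr_rows T g : all (ltn^~ (size (labs k w))) T ->
  iter (size T) phi (restr (rows [seq sset k (nth [::] (labs k w) l) | l <- T] g)) =
  (all (minor k w A) T)%:R * restr g.
Proof.
elim: T => [|l T IH] /=; first by rewrite mul1r.
case/andP=> hl hT; rewrite -iterS iterSr restrM /restr subXn -/restr phi_sqr phi_restr //; case: minor; rewrite ?mul1r ?mul0r ?IH //=.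
by elim: (size T) => //= n ->; rewrite phi0.
Qed.

End Points.

Lemma mem_subs u w s : subseq u s -> size u = w -> u \in subs w s.
Proof.
elim: s w u => [|x s IH] w u /=; first by case: w u => [|w] [|y u].
case: u => [_ <-|y u]; first by rewrite mem_cat IH ?orbT // sub0seq.
case: w => [|w] //; rewrite mem_cat; case: eqP => [-> su [su']|_ su sw].
  by rewrite map_f // IH.
by rewrite IH ?orbT.
Qed.

Lemma mp_natr k n : n%:R = (odd n)%:R :> P k.
Proof.
rewrite -[n in LHS]odd_double_half natrD -muln2 natrM.
by rewrite [2%:R](mp_addxx 1) mulr0 addr0.
Qed.

(** * Sums and pullbacks of functionals that kill hits *)

Section HitFree.
Variable k : nat.

Lemma hitfree_sum n (J : Type) (r : seq J) (x : J -> 'F_2) (K : J -> P k -> 'F_2) :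
  (forall j, hitfree n (K j)) -> hitfree n (fun f => \sum_(j <- r) x j * K j f).
Proof.
move=> HK; split=> [f g|f|m hm].
- by rewrite -big_split; apply: eq_bigr => j _; rewrite (KD (HK j)) mulrDr.
- by apply: eq_bigr => j _; rewrite (KSq (HK j)).
- by rewrite big1 // => j _; rewrite (Kdeg (HK j)) ?mulr0.
Qed.

Lemma eq_hitfree n (K K' : P k -> 'F_2) : K =1 K' -> hitfree n K -> hitfree n K'.
Proof.
move=> e HK; split=> [f g|f|m hm]; first by rewrite -!e (KD HK).
  by rewrite -!e (KSq HK).
by rewrite -e (Kdeg HK).
Qed.

Lemma hitfreeD n (K K' : P k -> 'F_2) : hitfree n K -> hitfree n K' -> hitfree n (fun f => K f + K' f).
Proof.
move=> HK HK'; split=> [f g|f|m hm].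
- by rewrite (KD HK) (KD HK') addrACA.
- by rewrite (KSq HK) (KSq HK').
- by rewrite (Kdeg HK) ?(Kdeg HK') ?addr0.
Qed.

Lemma KbM n (K : P k -> 'F_2) (b : bool) f : hitfree n K -> K (b%:R * f) = b%:R * K f.
Proof. by move=> HK; case: b; rewrite ?mul1r // !mul0r (K0 HK). Qed.

Lemma phi_hitfree N (K : P k -> 'F_2) : hitfree N K -> hitfree (k + N.*2) (fun f => K (phi f)).
Proof.
move=> HK; split=> [f g|f|m hm]; first by rewrite phiD (KD HK).
  by rewrite phi_Sq (KSq HK).
rewrite mon_split phi_monoid; case: eqP => [e|_]; last exact: K0 HK.
apply: (Kdeg HK); apply: contra hm => /eqP <-; apply/eqP.
have -> : mdeg m = (#|oddset m| + (mdeg (halfm m)).*2)%N.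
  rewrite !mdegE -sum1_card -muln2 big_distrl /= [X in (X + _)%N]big_mkcond -big_split /=.
  apply: eq_bigr => i _; rewrite inE mnmE muln2 -[m i in LHS]odd_double_half.
  by case: odd.
by rewrite e cardsT card_ord.
Qed.

Lemma iter_phi_hitfree N e (K : P k -> 'F_2) : hitfree N K ->
  hitfree (row_degree k N e) (fun f => K (iter e phi f)).
Proof.
move=> HK; elim: e => [|e IH] /=; first by [].
by apply: eq_hitfree (phi_hitfree IH) => f; rewrite -iterSr.
Qed.

(** In [k] variables only the full row has size [k], so a functional that vanishes on smaller first
    rows factors through [phi]; induction strips [e] full rows. *)
Lemma full_hitfree N e (K : P k -> 'F_2) : (forall r, low_vanish k (row_degree k N r.+1)) ->
  hitfree (row_degree k N e) K -> exists2 K', hitfree N K' & forall f, K f = K' (iter e phi f).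
Proof.
move=> lvs; elim: e K => [|e IH] K HK; first by exists K.
have cT : #|[set: 'I_k]| = k by rewrite cardsT card_ord.
have [K' HK' E] := IH _ (lrow_hitfree lvs HK cT); exists K' => // f.
rewrite iterSr -E; elim/mp_split_ind: f => [|J m|f g If Ig].
- by rewrite phi0 (K0 HK) (K0 (lrow_hitfree lvs HK cT)).
- rewrite phi_monoid; case: eqVneq => [->//|nJ].
  rewrite (K0 (lrow_hitfree lvs HK cT)); apply: (lvs _ _ _ HK).
  by rewrite -[X in (_ < X)%N]cT proper_card // properEneq nJ subsetT.
- by rewrite phiD (KD HK) (KD (lrow_hitfree lvs HK cT)) If Ig.
Qed.

End HitFree.

(** * Lifting dual bases from the subspaces to the ambient space *)

Section LevelTheorem.
Variables (k w D passes N d : nat) (B : seq (seq nat)) (inv : seq (seq bool)).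
Hypothesis cert : certificate k w D passes B inv.
Hypotheses (D3 : (2 < D)%N) (w0 : (0 < w)%N) (wk : (w < k)%N) (kw : (k <= w.+2)%N).
Hypothesis lvs : forall r, low_vanish w (row_degree w N r.+1).
Hypothesis Dd : (D <= d)%N.
Hypothesis swp : forall r, ((d - D).+2 <= r)%N -> @rows_commute k w N r.

Let m := size (labs k w).
Let n := size (pts k w).
Let lset l := sset k (nth [::] (labs k w) l).
Let lrows T (g : P k) := rows (map lset T) g.
Let Aof W := nth [::] (pts k w) W.

Lemma subs_iota v X : X \in subs v (iota 0 k) ->
  [/\ uniq X, all (ltn^~ k) X, sorted leq X & size X = v].
Proof.
move=> /subsP [sX zX]; split=> //.
- exact: subseq_uniq sX (iota_uniq _ _).
- by apply/allP => x /(mem_subseq sX); rewrite mem_iota.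
- by apply: (subseq_sorted leq_trans sX); apply: iota_sorted.
Qed.

Lemma card_lset l : (l < m)%N -> #|lset l| = w.
Proof. by move=> hl; have [u a _ <-] := subs_iota (mem_nth [::] hl); apply: card_sset. Qed.

Lemma wsets_lset T : all (ltn^~ m) T -> all (fun J : {set 'I_k} => #|J| == w) (map lset T).
Proof. by rewrite all_map; apply: sub_all => l hl /=; rewrite card_lset. Qed.

Lemma lset_lab X : (lab k w X < m)%N -> lset (lab k w X) = sset k X.
Proof. by rewrite index_mem => h; rewrite /lset nth_index // sset_sort. Qed.

Lemma lset_surj (J : {set 'I_k}) : #|J| = w -> exists2 l, (l < m)%N & J = lset l.
Proof.
move=> hJ; pose X := [seq val i | i <- enum J].
have hX : X \in labs k w.
  apply: mem_subs; last by rewrite size_map -cardE.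
  by rewrite -val_enum_ord; apply: map_subseq; rewrite [enum 'I_k]enumT; apply: filter_subseq.
exists (index X (labs k w)); first by rewrite index_mem.
rewrite /lset nth_index //; apply/setP => i; rewrite inE.
by rewrite (mem_map val_inj) mem_enum.
Qed.

Lemma wsets_surj (T : seq {set 'I_k}) : all (fun J : {set 'I_k} => #|J| == w) T ->
  exists2 T', all (ltn^~ m) T' & T = map lset T'.
Proof.
elim: T => [|J T IH] /=; first by exists [::].
case/andP => /eqP /lset_surj [l hl ->] /IH [T' hT' ->].
by exists (l :: T') => //=; rewrite hl.
Qed.

Lemma lab_rem I i : I \in subs w.+1 (iota 0 k) -> i \in I -> (lab k w (rem i I) < m)%N.
Proof.
move=> hI iI; have [sI zI] := subsP hI; have [_ _ oI _] := subs_iota hI.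
rewrite /lab sorted_sort; last 2 first.
- exact: leq_trans.
- exact: (subseq_sorted leq_trans (rem_subseq _ _)).
rewrite index_mem mem_subs ?size_rem ?zI //.
exact: subseq_trans (rem_subseq _ _) sI.
Qed.

Lemma big_gen (L A : seq nat) (F : nat -> 'F_2) (G : 'I_k -> 'F_2) :
  uniq L -> all (ltn^~ k) L -> (forall i : 'I_k, val i \in L -> val i \notin A -> G i = F i) ->
  \sum_(i in sset k L :\: sset k A) G i = 0 ->
  \sum_(i <- [seq i <- L | i \notin A]) F i = 0.
Proof.
move=> uL lL FG; have -> : sset k L :\: sset k A = sset k [seq i <- L | i \notin A].
  by apply/setP => i; rewrite !inE mem_filter.
rewrite -(@big_sset _ _ _ k _ F) ?filter_uniq //; last first.
  by apply/allP => i; rewrite mem_filter => /andP[_ /(allP lL)].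
apply: etrans; apply: eq_bigr => i; rewrite inE mem_filter => /andP[iA iL].
by rewrite FG.
Qed.

Lemma row_relfun_rows (K : P k -> 'F_2) g : hitfree (row_degree w N d) K ->
  row_relfun k w D (fun T => K (lrows T g)).
Proof.
move=> HK; have [lok _ _ _ _] := cert.
have HKd r : (r <= d)%N -> hitfree (row_degree w N (r + (d - r))) K by move=> hr; rewrite subnKC.
split=> [T T' sT Tm pT|q T hq sT Tm|q T hq sT Tm].
- apply: (@rows_perm k w N lvs (d - D)) => //; last exact: perm_map.
    by rewrite size_map sT; apply: HKd.
  exact: wsets_lset.
- have lq := allP lok q; rewrite mem_cat hq in lq; have {}lq := allP (lq isT).
  case/allpairsP: hq => -[L A] [/= hL hA Eq]; have [uL lL _ zL] := subs_iota hL.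
  have [uA lA _ zA] := subs_iota hA.
  have cL : #|sset k L| = w.+1 by rewrite card_sset.
  have cA : #|sset k A|.+1 = w by rewrite card_sset // zA prednK.
  rewrite Eq big_map; apply: (big_gen uL lL _
    (quad_rel lvs (lrows T g) (HKd 2 (leq_trans (ltnW D3) Dd)) cL cA)) => i iL iA.
  have : [:: lab k w (rem (val i) L); lab k w (val i :: A)] \in q.
    by rewrite Eq; apply/mapP; exists (val i); rewrite // mem_filter iA.
  move=> /lq /and3P [h1 h2 _].
  by rewrite -(sset_rem i uL) -(sset_cons A i) -(lset_lab h1) -(lset_lab h2).
- have lq := allP lok q; rewrite mem_cat hq orbT in lq; have {}lq := allP (lq isT).
  case/allpairsP: hq => -[L A] [/= hL hA Eq]; have [uL lL _ zL] := subs_iota hL.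
  have [uA lA _ zA] := subs_iota hA.
  have cL : #|sset k L| = w.+1 by rewrite card_sset.
  have cA : #|sset k A|.+1 = w by rewrite card_sset // zA prednK.
  rewrite Eq big_map; apply: (big_gen uL lL _
    (cubic_rel lvs (lrows T g) (HKd 3 (leq_trans D3 Dd)) cL cA)) => i iL iA.
  have : [:: lab k w (rem (val i) L); lab k w (rem (val i) L); lab k w (val i :: A)] \in q.
    by rewrite Eq; apply/mapP; exists (val i); rewrite // mem_filter iA.
  move=> /lq /and4P [h1 _ h2 _].
  by rewrite -(sset_rem i uL) -(sset_cons A i) -(lset_lab h1) -(lset_lab h2).
Qed.

(** The coefficient of [K] at the point [W], a functional of what follows the first [D] rows. *)
Definition local_fun (K : P k -> 'F_2) (W : nat) (g : P k) : 'F_2 :=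
  acoef k w B inv (fun T => K (lrows T g)) W.

Lemma basis_labels b : b \in B -> size b = D /\ all (ltn^~ m) b.
Proof.
have [_ _ _ /and3P [_ /allP hB _] _] := cert.
by move=> /hB /andP [/eqP].
Qed.

Lemma nth_basis (j : 'I_n) : nth [::] B j \in B.
Proof.
have [_ _ _ /and3P [/eqP sB _ _] _] := cert.
by rewrite mem_nth // sB.
Qed.

Lemma local_fun_hitfree K W : hitfree (row_degree w N d) K ->
  hitfree (row_degree w N (d - D)) (local_fun K W).
Proof.
move=> HK; apply: hitfree_sum => j; have [sb lb] := basis_labels (nth_basis j).
apply: (rows_hitfree lvs (wsets_lset lb)).
by rewrite size_map sb subnKC.
Qed.

Lemma local_fun_rows K T g : hitfree (row_degree w N d) K -> size T = D -> all (ltn^~ m) T ->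
  K (lrows T g) = \sum_(W < n) (all (minor_at k w W) T)%:R * local_fun K W g.
Proof.
move=> HK sT lT; have [lok pok dok iok _] := cert.
exact: (localize D3 lok iok pok dok (row_relfun_rows g HK) sT lT).
Qed.

(** As functions of the point, these values are orthogonal to all products of [D - 1] minors, by
    [lrow_rel] below [D - 1] fixed rows. They are zero where the form is zero, so [separate]
    applies. *)
Lemma local_fun_rel K I W g : hitfree (row_degree w N d) K -> I \in subs w.+1 (iota 0 k) -> (W < n)%N ->
  local_fun K W ((\sum_(i < k | xi k w I W i) 'X_i) * g) = 0.
Proof.
move=> HK hI; have [_ _ _ _ [sok _]] := cert.
have [uI lI _ zI] := subs_iota hI.
(* [insub] converts [i] to an index below [k]; the default 0 is never reached for [i] in [I]. *)
pose G W := \sum_(i <- I) (minor_at k w W (lab k w (rem i I)))%:R *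
  (if insub i is Some i' then local_fun K W ('X_i' * g) else 0).
have GE W' : local_fun K W' ((\sum_(i < k | xi k w I W' i) 'X_i) * g) = G W'.
  rewrite mulr_suml (Ksum (local_fun_hitfree W' HK)) /G.
  rewrite -(@big_sset _ _ _ k) // big_mkcond [RHS]big_mkcond; apply: eq_bigr => i _.
  rewrite inE /xi valK; case: (val i \in I) => //=.
  by case: minor_at; rewrite ?mul1r ?mul0r.
move: W => W0 hW0; rewrite GE; move: W0 hW0; apply: (separate (D := D) sok hI) => [T sT lT|W hW h0].
- under eq_bigr => W _ do rewrite /G mulr_sumr.
  rewrite exchange_big /= -(@big_sset _ _ _ k) //=.
  have HT : hitfree (row_degree w N (d - D).+1) (fun h => K (lrows T h)).
    apply: (rows_hitfree lvs (wsets_lset lT)).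
    by rewrite size_map sT; move: HK; congr hitfree; congr row_degree; lia.
  have cI : #|sset k I| = w.+1 by rewrite card_sset.
  apply: etrans (lrow_rel lvs g HT cI); apply: eq_bigr => i; rewrite inE => iI.
  have hl := lab_rem hI iI.
  rewrite valK /krow -(sset_rem i uI) -(lset_lab hl).
  have -> : K (lrows T (xprod (lset (lab k w (rem (val i) I))) * ('X_i * g) ^+ 2)) =
    K (lrows (T ++ [:: lab k w (rem (val i) I)]) ('X_i * g)).
    by rewrite /lrows map_cat rows_cat.
  rewrite local_fun_rows //; last 2 first.
  + by rewrite size_cat sT addn1 prednK // ltnW // ltnW.
  + by rewrite all_cat lT /= hl.
  by apply: eq_bigr => W _; rewrite all_cat /= andbT -mulnb natrM mulrA.
- rewrite /G big_seq big1 // => i iI; have := h0 i iI; rewrite /xi iI /= => /negbTE ->.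
  by rewrite mul0r.
Qed.

Lemma pts_okP W : (W < n)%N ->
  [/\ size (Aof W) = k, forall j, (j < w)%N -> (piv w (Aof W) j < k)%N &
   forall i, (i < k)%N -> xipiv k w (Aof W) i = nseq k false \/
     exists2 I, I \in subs w.+1 (iota 0 k) & xipiv k w (Aof W) i = mkseq (xi k w I W) k].
Proof.
have [_ _ _ _ [_ pok]] := cert => hW.
have Wn : W \in iota 0 (size (pts k w)) by rewrite mem_iota.
have /and4P [/eqP sA _ /allP hp /allP hx] := allP pok W Wn.
split=> // [j hj|i hi]; first by apply: hp; rewrite mem_iota.
have : i \in iota 0 k by rewrite mem_iota.
by move=> /hx /orP[/eqP|/hasP [I hI /eqP]]; [left | right; exists I].
Qed.

Lemma xipiv_poly W (i : 'I_k) :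
  'X_i + @sect k w (Aof W) (@restr k w (Aof W) 'X_i) =
  \sum_(i' < k | nth false (xipiv k w (Aof W) i) i') 'X_i'.
Proof.
set A := Aof W.
have e1 : 'X_i = \sum_(i' < k) (i' == i)%:R * 'X_i' :> P k.
  by rewrite (bigD1 i) //= eqxx mul1r big1 ?addr0 // => i' /negbTE ->; rewrite mul0r.
pose b (i' : 'I_k) j := nth false (nth [::] A i) j && (val i' == piv w A j).
have e2 : @sect k w A (@restr k w A 'X_i) =
    \sum_(i' < k) (count (b i') (iota 0 w))%:R * 'X_i' :> P k.
  rewrite /restr subX /pcol /sect /lin sub_sum.
  transitivity (\sum_(j < w) \sum_(i' < k) (b i' j)%:R * 'X_i' : P k).
    rewrite big_mkcond; apply: eq_bigr => j _; rewrite subX /psec /b.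
    case: nth => /=; last by rewrite big1 // => i' _; rewrite mul0r.
    by rewrite big_mkcond; apply: eq_bigr => i' _; case: eqP; rewrite ?mul1r ?mul0r.
  rewrite exchange_big; apply: eq_bigr => i' _; rewrite -mulr_suml -natr_sum.
  congr (_%:R * _); rewrite -sum1_count [RHS]big_mkcond -(big_mkord xpredT (fun j => b i' j : nat)).
  by rewrite /index_iota subn0; apply: eq_bigr => j _; case: b.
rewrite [X in X + _]e1 e2 -big_split [RHS]big_mkcond /=; apply: eq_bigr => i' _.
rewrite nth_mkseq // -mulrDl [(count _ _)%:R]mp_natr -val_eqE.
case: (val i' == val i); case: (odd _) => /=; rewrite ?addr0 ?add0r ?mul1r ?mul0r //.
by rewrite mp_addxx mul0r.
Qed.

(** The functional kills the ideal generated by the forms [xipiv], so it depends only on the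
    restriction to the subspace [W]. *)
Lemma local_fun_sect K W f : hitfree (row_degree w N d) K -> (W < n)%N ->
  local_fun K W f = local_fun K W (@sect k w (Aof W) (@restr k w (Aof W) f)).
Proof.
move=> HK hW; have HL := local_fun_hitfree W HK.
pose tau f := @sect k w (Aof W) (@restr k w (Aof W) f).
(* The extra factor [g] lets the induction pass through products. *)
suff Q : forall g, local_fun K W ((f + tau f) * g) = 0.
  by have := Q 1; rewrite mulr1 (KD HL) => /F2_add_eq0.
move: f; apply: mp_alg_ind => [||i|f1 f2 I1 I2|f1 f2 I1 I2] g.
- by rewrite /tau /restr sub0 /sect sub0 addr0 mul0r (K0 HL).
- by rewrite /tau /restr sub1 /sect sub1 mp_addxx mul0r (K0 HL).
- rewrite /tau xipiv_poly; have [_ _ hx] := pts_okP hW.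
  have [->|[I hI ->]] := hx i (ltn_ord i).
    by rewrite big1 ?mul0r ?(K0 HL) // => i'; rewrite nth_nseq if_same.
  rewrite -[RHS](local_fun_rel g HK hI hW); congr (local_fun K W (_ * g)).
  by apply: eq_bigl => i'; rewrite nth_mkseq.
- rewrite /tau restrD sectD addrACA mulrDl (KD HL); set x := local_fun _ _ _; set y := local_fun _ _ _.
  by rewrite {}/x {}/y I1 I2 addr0.
- rewrite /tau restrM sectM -/(tau f1) -/(tau f2).
  have -> : (f1 * f2 + tau f1 * tau f2) * g = (f1 + tau f1) * (f2 * g) + (f2 + tau f2) * (tau f1 * g).
    have cancel2 (x y z : P k) : x + y + (y + z) = x + z.
      by rewrite addrA -[x + y + y]addrA mp_addxx addr0.
    rewrite [RHS]/= mulrDl [X in _ = X + _]mulrDl [X in _ = _ + X]mulrDl (mulrCA f2) cancel2.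
    by rewrite mulrA [tau f2 * _]mulrCA mulrA.
  by rewrite (KD HL) I1 I2 addr0.
Qed.

Variables (J : finType) (E : J -> P w -> 'F_2) (eg : J -> P w).
Hypothesis EK : forall j, hitfree N (E j).
Hypothesis Edual : forall i j, E i (eg j) = (i == j)%:R.
Hypothesis Espan : forall L, hitfree N L -> exists c : J -> 'F_2, forall f, L f = \sum_j c j * E j f.

(** On the subspace, rows of size [w] are full rows; [phi] strips [d] of them and a basis functional
    in the [w] parameters evaluates the rest. *)
Definition lift_fun (p : 'I_n * J) (f : P k) : 'F_2 :=
  E p.2 (iter d phi (@restr k w (Aof p.1) f)).

Lemma lift_hitfree p : hitfree (row_degree w N d) (lift_fun p).
Proof.
have H := iter_phi_hitfree d (EK p.2); split=> [f g|f|x hx]; rewrite /lift_fun.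
- by rewrite restrD (KD H).
- by rewrite restr_Sq (KSq H).
- by apply: (Khomog H _ hx); apply: restr_homog; apply: mon_homog.
Qed.

Lemma lift_rows p T g : size T = D -> all (ltn^~ m) T ->
  lift_fun p (lrows T g) =
  (all (minor_at k w p.1) T)%:R * E p.2 (iter (d - D) phi (@restr k w (Aof p.1) g)).
Proof.
move=> sT lT; have e := phi_restr_rows (Aof p.1) g lT; rewrite sT in e.
rewrite /lift_fun -[X in iter X](subnK Dd) iterD e.
rewrite -/(minor_at k w p.1); case: all; rewrite ?mul1r ?mul0r //.
by elim: (d - D)%N => [|u IH]; rewrite ?iterSr ?phi0 // (K0 (EK _)).
Qed.

Definition upw (f : P w) : P w := xprod setT * f ^+ 2.

(** Row [W] of [inv] weights the words of [B] so as to single out the point [W]; [upw], a right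
    inverse of [phi], supplies the other [d - D] full rows, and [sect] lifts the result from the
    subspace. *)
Definition lift_dual (p : 'I_n * J) : P k :=
  \sum_(i < n) (nth false (nth [::] inv p.1) i)%:R *
    lrows (nth [::] B i) (@sect k w (Aof p.1) (iter (d - D) upw (eg p.2))).

Lemma lift_dualP p q : lift_fun p (lift_dual q) = (p == q)%:R.
Proof.
have [lok pok dok iok _] := cert.
rewrite /lift_dual (Ksum (lift_hitfree p)).
under eq_bigr => i _.
  rewrite (KbM _ _ (lift_hitfree p)); have [sb lb] := basis_labels (nth_basis i).
  rewrite lift_rows // mulrA; over.
rewrite -mulr_suml (inverseP iok) // val_eqE eq_sym.
case: p q => [W j] [W' j'] /=; rewrite xpair_eqE; case: eqP => [<-|_]; last by rewrite mul0r.
have [sA hp _] := pts_okP (ltn_ord W).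
rewrite mul1r restr_sect // /= -Edual; congr (E j _).
elim: (d - D)%N => //= e {2}<-; rewrite -iterS iterSr /upw phi_sqr phi_xprod eqxx mul1r //.
Qed.

Lemma phi_lift_dual p : phi (lift_dual p) = 0.
Proof.
rewrite /lift_dual; elim/big_ind: _ => [|f g If Ig|i _]; first exact: phi0.
  by rewrite phiD If Ig addr0.
have [sb lb] := basis_labels (nth_basis i).
case: (nth [::] B i) sb lb => [sD|l T _]; first by move: D3; rewrite -sD.
case/andP => hl _; case: (nth false _ _); last by rewrite mul0r phi0.
have -> : true%:R = 1 :> P k by [].
rewrite mul1r phi_sqr phi_xprod; case: eqP => [e|]; last by rewrite mul0r.
by exfalso; have := wk; have := card_lset hl; rewrite e cardsT card_ord => ->; rewrite ltnn.
Qed.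

(** The bound on [I] leaves out the full first row when [k = w.+2]; that part is the one seen by
    Kameko's map. *)
Lemma lift_span K : hitfree (row_degree w N d) K -> exists c : 'I_n * J -> 'F_2,
  forall (I : {set 'I_k}) g, (#|I| <= w.+1)%N ->
    K (xprod I * g ^+ 2) = \sum_p c p * lift_fun p (xprod I * g ^+ 2).
Proof.
move=> HK.
have [c Ec] : exists c : 'I_n -> J -> 'F_2, forall (W : 'I_n) f,
    local_fun K W f = \sum_j c W j * E j (iter (d - D) phi (@restr k w (Aof W) f)).
  apply: (@fin_all_exists _ _ (fun (W : 'I_n) cW => forall f, local_fun K W f =
    \sum_j cW j * E j (iter (d - D) phi (@restr k w (Aof W) f)))) => W.
  have HL := local_fun_hitfree W HK.
  have HS : hitfree (row_degree w N (d - D)) (fun f => local_fun K W (@sect k w (Aof W) f)).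
    split=> [f g|f|x hx]; first by rewrite sectD (KD HL).
      by rewrite sect_Sq (KSq HL).
    by apply: (Khomog HL _ hx); apply: sect_homog; apply: mon_homog.
  have [L HLN EL] := full_hitfree lvs HS; have [cW EcW] := Espan HLN.
  exists cW => f; rewrite (local_fun_sect f HK (ltn_ord W)) EL EcW //.
pose c' (p : 'I_n * J) := c p.1 p.2; exists c' => I g hI.
(* By the choice of [c] this difference vanishes on all blocks of [D] rows of size [w], and
   [det_rows] extends the vanishing to every first row of size [w]. *)
pose K' f := K f + \sum_p c' p * lift_fun p f.
have HK' : hitfree (row_degree w N d) K'.
  by apply: hitfreeD => //; apply: hitfree_sum => p; apply: lift_hitfree.
apply: F2_add_eq0; rewrite -/(K' _).
have d0 : (0 < d)%N by apply: leq_trans Dd; apply: leq_trans D3.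
have HK1 : hitfree (row_degree w N d.-1.+1) K' by rewrite prednK.
have [lt|ge] := ltnP #|I| w; first exact: lvs HK1 _ _ lt.
have [eI|nI] := eqVneq #|I| w.+1.
  by apply: (K_parity HK1); rewrite eI /= oddD odd_double addbF; case: odd.
have {ge nI hI} hI : #|I| = w by apply/eqP; rewrite eqn_leq ge andbT -ltnS ltn_neqAle nI.
apply: (det_rows lvs (D := D.-1) (r := (d - D)%N) kw) => //.
  by rewrite prednK ?subnKC // ltnW // ltnW.
move=> T g'; rewrite prednK => [sT wT|]; last by rewrite ltnW // ltnW.
have [T' lT' ET] := wsets_surj wT.
have sT' : size T' = D by rewrite -sT ET size_map.
rewrite ET -/(lrows T' g') /K'.
have -> : \sum_p c' p * lift_fun p (lrows T' g') = K (lrows T' g'); last exact: F2_addxx.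
rewrite local_fun_rows //; transitivity (\sum_(W < n) \sum_j c W j * lift_fun (W, j) (lrows T' g')).
  by rewrite pair_bigA; apply: eq_bigr => -[W j].
apply: eq_bigr => W _; rewrite Ec mulr_sumr; apply: eq_bigr => j _.
by rewrite lift_rows // mulrCA.
Qed.

End LevelTheorem.

(** * Comparison with the vector spaces of the statement *)

Lemma linfunE (R : nzRingType) (U V : vectType R) (f : U -> V) : linear f -> linfun f =1 f.
Proof.
move=> lf; pose F : {linear U -> V} := HB.pack f (GRing.isLinear.Build _ _ _ _ f lf).
exact: (lfunE F).
Qed.

Section Bridge.
Variable k : nat.

Definition mnm_of d (a : mon k d) : 'X_{1..k} := [multinom expo a i | i < k].

Lemma mdeg_mnm_of d (a : mon k d) : mdeg (mnm_of a) = d.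
Proof. by rewrite mdegE -[RHS](eqP (valP a)); apply: eq_bigr => i _; rewrite mnmE. Qed.

Lemma mnm_of_inj d : injective (@mnm_of d).
Proof.
move=> a b /mnmP e; apply: val_inj; apply/ffunP => i; apply: val_inj.
by have := e i; rewrite !mnmE.
Qed.

Lemma mnm_of_surj d (m : 'X_{1..k}) : mdeg m = d -> exists a : mon k d, mnm_of a = m.
Proof.
move=> hm; have le i : (m i < d.+1)%N.
  by rewrite ltnS -hm mdegE (bigD1 i) //= leq_addr.
have P : (\sum_(j < k) ([ffun j => Ordinal (le j)] j : nat))%N == d.
  by rewrite -[X in _ == X]hm mdegE; apply/eqP; apply: eq_bigr => i _; rewrite ffunE.
exists (exist _ [ffun j => Ordinal (le j)] P).
by apply/mnmP => i; rewrite mnmE /expo /= ffunE.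
Qed.

Definition toP d (f : HP k d) : P k := \sum_(a : mon k d) f a *: 'X_[mnm_of a].
Definition fromP d (p : P k) : HP k d := [ffun a => p@_(mnm_of a)].

Lemma mcoeff_toP d (f : HP k d) (a : mon k d) : (toP f)@_(mnm_of a) = f a.
Proof.
rewrite raddf_sum (bigD1 a) //= mcoeffZ mcoeffX eqxx mulr1 big1 ?addr0 // => b ne.
by rewrite mcoeffZ mcoeffX (inj_eq (@mnm_of_inj d)) (negbTE ne) mulr0.
Qed.

Lemma toPK d : cancel (@toP d) (@fromP d).
Proof. by move=> f; apply/ffunP => a; rewrite ffunE mcoeff_toP. Qed.

Lemma toP_linear d : linear (@toP d).
Proof.
move=> c f g; rewrite /toP scaler_sumr -big_split; apply: eq_bigr => a _.
by rewrite !ffunE scalerDl scalerA.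
Qed.

Lemma toPD d : {morph @toP d : f g / f + g}.
Proof. by move=> f g; have := toP_linear 1 f g; rewrite !scale1r. Qed.

Lemma fromPD d : {morph @fromP d : f g / f + g}.
Proof. by move=> f g; apply/ffunP => a; rewrite !ffunE mcoeffD. Qed.

Lemma toP_homog d (f : HP k d) : toP f \is d.-homog.
Proof.
apply: rpred_sum => a _; apply: rpredZ.
by have := mon_homog (mnm_of a); rewrite mdeg_mnm_of.
Qed.

Lemma K_fromP n (K : P k -> 'F_2) p : hitfree n K -> K (toP (fromP n p)) = K p.
Proof.
move=> HK; elim/mp_add_ind: p => [|m|p q Ip Iq].
- have -> : fromP n 0 = 0 by apply/ffunP => a; rewrite !ffunE mcoeff0.
  by rewrite /toP big1 // => a _; rewrite ffunE scale0r.
- have [/mnm_of_surj [a <-]|ne] := eqVneq (mdeg m) n.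
    rewrite /toP (bigD1 a) //= big1 ?addr0 => [|b nb].
      by rewrite ffunE mcoeffX eqxx scale1r.
    by rewrite ffunE mcoeffX (inj_eq (@mnm_of_inj n)) eq_sym (negbTE nb) scale0r.
  rewrite (Kdeg HK ne) /toP big1 ?(K0 HK) // => a _; rewrite ffunE mcoeffX.
  by case: eqP => [e|_]; rewrite ?scale0r //; case/eqP: ne; rewrite e mdeg_mnm_of.
- by rewrite fromPD toPD (KD HK) Ip Iq (KD HK).
Qed.

Lemma sq_fromP e n (f : HP k e) : sq n f = fromP n (Sq (toP f)).
Proof.
apply/ffunP => b; rewrite !ffunE /toP Sq_sum raddf_sum; apply: eq_bigr => a _ /=.
have -> : Sq (f a *: 'X_[mnm_of a]) = f a *: Sq ('X_[mnm_of a] : P k).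
  by case: (F2_cases (f a)) => ->; rewrite ?scale0r ?Sq0 ?scale1r.
rewrite mcoeffZ mcoeff_Sq /sq_coef; congr (_ * (_ * _)%N%:R).
  by congr (nat_of_bool _); apply: eq_forallb => j; rewrite !mnmE.
by apply: eq_bigr => j _; rewrite !mnmE.
Qed.

Lemma sq_linear e n : linear (@sq k e n).
Proof.
move=> c f g; apply/ffunP => b; rewrite !ffunE scaler_sumr -big_split.
by apply: eq_bigr => a _; rewrite !ffunE mulrDl scalerAl.
Qed.

Lemma sq_hit e n (f : HP k e) : (e < n)%N -> sq n f \in hit k n.
Proof.
move=> en; have := memv_img (linfun (@sq k e n)) (memvf f).
rewrite (linfunE (@sq_linear e n)); apply: (subvP (sumv_sup (Ordinal en) _ _)) => //.
Qed.

Lemma K_hit n (K : P k -> 'F_2) (f : HP k n) : hitfree n K -> f \in hit k n -> K (toP f) = 0.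
Proof.
move=> HK /memv_sumP [vs hvs ->].
have toPsum (I : Type) (r : seq I) (p : pred I) (F : I -> HP k n) :
    toP (\sum_(i <- r | p i) F i) = \sum_(i <- r | p i) toP (F i).
  elim/big_rec2: _ => [|i x y _ <-]; last exact: toPD.
  by rewrite /toP big1 // => a _; rewrite ffunE scale0r.
rewrite toPsum (Ksum HK) big1 // => e _; have /memv_imgP [u _ ->] := hvs e isT.
rewrite (linfunE (@sq_linear e n)) sq_fromP (K_fromP _ HK) (KSq HK).
by apply: (Khomog HK (toP_homog u)); rewrite neq_ltn ltn_ord.
Qed.

(** If [f] were not hit, some coordinate of [f - projv U f] would be nonzero; this coordinate,
    extended by zero to the other degrees, is a functional that kills hits but not [f]. *)
Lemma hit_separated n (f : HP k n) :
  (forall K : P k -> 'F_2, hitfree n K -> K (toP f) = 0) -> f \in hit k n.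
Proof.
move=> h; apply: contraT => nf; set U := hit k n in nf *.
have /eqP/ffunP nz : f - projv U f != 0.
  by apply: contra nf; rewrite subr_eq0 => /eqP ->; apply: memv_proj.
have [a na] : exists a, (f - projv U f) a != 0.
  apply/existsP; apply: contraT => /existsPn z; exfalso; apply: nz => a.
  by rewrite [RHS]ffunE; apply/eqP; have := z a; rewrite negbK.
pose l (h : HP k n) : 'F_2 := (h - projv U h) a.
have lD g1 g2 : l (g1 + g2) = l g1 + l g2.
  by rewrite /l linearD opprD addrACA ffunE.
have lU g : g \in U -> l g = 0 by move=> gU; rewrite /l projv_id // subrr ffunE.
case/eqP: na; rewrite -[LHS]/(l f) -[f]toPK; apply: (h (fun p => l (fromP n p))).
split=> [p q|p|m nm]; first by rewrite fromPD lD.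
- elim/mp_add_ind: p => [|m|p q Ip Iq]; last first.
  + by rewrite SqD !fromPD !lD Ip Iq.
  (* Below degree [n], the degree [n] part of [Sq 'X_[m]] is hit. From degree [n] on, [Sq] only adds
     terms of degree above [n]. *)
  + have [lt|gt|e] := ltngtP (mdeg m) n.
    * have [b <-] := mnm_of_surj (erefl (mdeg m)).
      have eb : toP [ffun c : mon k (mdeg m) => (c == b)%:R] = 'X_[mnm_of b].
        rewrite /toP (bigD1 b) //= ffunE eqxx scale1r big1 ?addr0 // => c nc.
        by rewrite ffunE (negbTE nc) scale0r.
      rewrite -eb -sq_fromP (lU _ (sq_hit _ lt)).
      have -> : fromP n (toP [ffun c : mon k (mdeg m) => (c == b)%:R]) = 0; last first.
        by rewrite /l linear0 subr0 ffunE.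
      apply/ffunP => c; rewrite !ffunE; apply: (dhomog_nemf_coeff (toP_homog _)).
      apply/eqP => e; have e' : mdeg (mnm_of c) = mdeg m := e.
      by have := lt; rewrite -[X in (X < _)%N]e' mdeg_mnm_of ltnn.
    * congr l; apply/ffunP => c; rewrite !ffunE mcoeffX; case: eqP => [e|ne].
        by move: gt; rewrite e mdeg_mnm_of ltnn.
      apply: memN_msupp_eq0; apply/negP => hc.
      have := msupp_Sq_low hc; rewrite mdeg_mnm_of; case: eqP => [e|_ /(_ isT)].
        by case: ne.
      by rewrite ltnNge ltnW.
    * congr l; apply/ffunP => c; rewrite !ffunE mcoeffX; case: eqP => [<-|ne].
        by rewrite mcoeff_Sq_low.
      apply: memN_msupp_eq0; apply/negP => hc.
      have := msupp_Sq_low hc; rewrite mdeg_mnm_of e ltnn; case: eqP => [e'|_ /(_ isT) //].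
      by case: ne.
  + by rewrite Sq0.
- have -> : fromP n 'X_[m] = 0; last by rewrite /l linear0 subr0 ffunE.
  apply/ffunP => c; rewrite !ffunE mcoeffX; case: eqP => // e.
  by case/eqP: nm; rewrite e mdeg_mnm_of.
Qed.

Lemma kameko_linear n m : linear (@kameko k n m).
Proof.
move=> c f g; apply/ffunP => b; rewrite !ffunE scaler_sumr -big_split.
by apply: eq_bigr => a _; rewrite !ffunE.
Qed.

Lemma upm_mnm_of n m (b : mon k m) : n = (k + m.*2)%N -> exists a : mon k n, mnm_of a = upm (mnm_of b).
Proof.
move=> nm; apply: mnm_of_surj; rewrite nm -[in RHS](mdeg_mnm_of b) !mdegE -muln2 big_distrl /=.
transitivity (\sum_(i < k) 1 + \sum_(i < k) mnm_of b i * 2)%N; last by rewrite sum1_card card_ord.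
by rewrite -big_split; apply: eq_bigr => i _; rewrite mnmE muln2.
Qed.

Lemma kameko_fromP n m (f : HP k n) : n = (k + m.*2)%N ->
  kameko m f = fromP m (phi (toP f)).
Proof.
move=> nm; apply/ffunP => b; rewrite !ffunE mcoeff_phi.
have [a Ea] := upm_mnm_of b nm; rewrite -Ea mcoeff_toP (big_pred1 a) // => a'; rewrite /=.
apply/forallP/eqP => [h|-> j].
  apply: mnm_of_inj; rewrite Ea; apply/mnmP => i; rewrite !mnmE (eqP (h i)).
  by rewrite mul2n.
by move/mnmP: Ea => /(_ j); rewrite !mnmE mul2n => ->.
Qed.

Lemma kameko_of_fromP n m (p : P k) : n = (k + m.*2)%N ->
  kameko m (fromP n p) = fromP m (phi p).
Proof.
move=> nm; rewrite kameko_fromP //; apply/ffunP => b; rewrite !ffunE !mcoeff_phi.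
by have [a <-] := upm_mnm_of b nm; rewrite mcoeff_toP ffunE.
Qed.

End Bridge.

(** * The basis indexed by flags *)

Record dual_basis (k n : nat) (J : finType) (E : J -> P k -> 'F_2) (e : J -> P k) : Prop :=
  DualBasis {
    basis_hitfree : forall j, hitfree n (E j);
    basis_dual : forall i j, E i (e j) = (i == j)%:R;
    basis_span : forall L, hitfree n L ->
      exists c : J -> 'F_2, forall f, L f = \sum_j c j * E j f }.

(** The bottom of the tower: in degree 0 the constant coefficient spans all functionals. *)
Lemma dual_basis0 : dual_basis 0 (fun _ : unit => mcoeff 0 : P 1 -> 'F_2) (fun=> 1).
Proof.
split=> [_|[] []|L HL].
- split=> [f g|f|m nm]; first exact: mcoeffD.
    elim/mp_add_ind: f => [|m|f g If Ig]; first by rewrite Sq0.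
      have [->|nm] := eqVneq m 0%MM; first by rewrite mcoeff_Sq_low mcoeffX eqxx.
      rewrite mcoeffX (negbTE nm); apply: memN_msupp_eq0; apply/negP => h0.
      have := msupp_Sq_low h0; rewrite eq_sym nm => /(_ isT).
      by rewrite mdeg0.
    by rewrite SqD !mcoeffD If Ig.
  by rewrite mcoeffX; case: eqP => // e; rewrite e mdeg0 in nm.
- by rewrite mcoeff1 eqxx.
- exists (fun=> L 1) => f; rewrite big_const card_unit /= addr0.
  elim/mp_add_ind: f => [|m|f g If Ig]; first by rewrite mcoeff0 mulr0 (K0 HL).
    rewrite mcoeffX; case: eqVneq => [->|nm]; first by rewrite mpolyX0 mulr1.
    by rewrite mulr0 (Kdeg HL) // mdeg_eq0.
  by rewrite mcoeffD mulrDr -If -Ig (KD HL).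
Qed.

Section Hyper.
Variables (w D passes N d : nat) (B : seq (seq nat)) (inv : seq (seq bool)).
Hypothesis cert : certificate w.+1 w D passes B inv.
Hypotheses (D3 : (2 < D)%N) (w0 : (0 < w)%N).
Hypothesis lvs : forall r, low_vanish w (row_degree w N r.+1).
Hypothesis Dd : (D <= d)%N.

(** With [w.+1] variables the bound on the first row in [lift_span] always holds, so the lifted
    functionals span everything. *)
Lemma dual_basis_lift (J : finType) (E : J -> P w -> 'F_2) (e : J -> P w) : dual_basis N E e ->
  dual_basis (row_degree w N d) (lift_fun (k := w.+1) d E) (lift_dual (k := w.+1) D d B inv e).
Proof.
move=> [EK Edual Espan].
have swp r : ((d - D).+2 <= r)%N -> @rows_commute w.+1 w N r.
  by case: r => [|[|r]] // _; apply: swap_hyper.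
split=> [p|p q|L HL].
- exact: lift_hitfree.
- exact: (lift_dualP cert Dd EK Edual).
- have [c Ec] := lift_span cert D3 w0 (ltnSn _) (leqnSn _) lvs Dd swp EK Espan HL.
  exists c => f; elim/mp_split_ind: f => [|I m|f g If Ig].
  + rewrite (K0 HL) big1 // => p _; rewrite (K0 (lift_hitfree d EK p)) mulr0 //.
  + apply: Ec; have := subset_leq_card (subsetT I); rewrite cardsT card_ord //.
  + rewrite (KD HL) If Ig -big_split; apply: eq_bigr => p _.
    by rewrite (KD (lift_hitfree d EK p)) mulrDr.
Qed.

End Hyper.

Lemma ffun_delta (R : nzRingType) (J : finType) (g : {ffun J -> R^o}) :
  g = \sum_p g p *: [ffun q => (q == p)%:R : R^o].
Proof.
apply/ffunP => q; rewrite sum_ffunE (bigD1 q) //= !ffunE eqxx -[X in X *: _]mulr1 mulr1.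
rewrite big1 => [|p np]; first by rewrite addr0 -[RHS]/(g q * 1) mulr1.
by rewrite !ffunE eq_sym (negbTE np) scaler0.
Qed.

Lemma size_pts53 : size (pts 5 3) = 155%N. Proof. by []. Qed.
Lemma size_pts32 : size (pts 3 2) = 7%N. Proof. by []. Qed.
Lemma size_pts21 : size (pts 2 1) = 3%N. Proof. by []. Qed.

Lemma row_degree21E s t : row_degree 2 (row_degree 1 0 t) s = (2 ^ (s + t) + 2 ^ s - 2)%N.
Proof.
have e1 := row_degree_closed 1 0 t; have := row_degree_closed 2 (row_degree 1 0 t) s.
have -> : (row_degree 1 0 t + 2 = 2 ^ t + 1)%N by lia.
by rewrite mulnDr muln1 expnD; lia.
Qed.

(** * Flag functionals and the dimension of the kernel *)

Section Main.
Variables d s t : nat.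
Hypotheses (d6 : (6 <= d)%N) (s4 : (4 <= s)%N) (t4 : (4 <= t)%N).

Let N1 := row_degree 1 0 t.
Let N2 := row_degree 2 N1 s.

(** Two levels of codimension 1: lines in a plane, then planes in a 3-space. The level of 3-spaces
    in F_2^5 has codimension 2 and goes through [lift_span]. *)
Let b1 := dual_basis_lift cert21 isT isT (@low_vanish1 0) (leq_trans (isT : (3 <= 4)%N) t4) dual_basis0.
Let b2 := dual_basis_lift cert32 isT isT (@low_vanish2 N1) s4 b1.
Let EK := basis_hitfree b2.
Let Edual := basis_dual b2.
Let Espan := basis_span b2.

Let n := row_degree 3 N2 d.
Variable m : nat.
Hypothesis nm : n = (5 + m.*2)%N.

Let J : finType := ('I_(size (pts 5 3)) * ('I_(size (pts 3 2)) * ('I_(size (pts 2 1)) * unit)))%type.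
Let E2 := lift_fun (k := 3) s (lift_fun (k := 2) t (fun _ : unit => mcoeff 0 : P 1 -> 'F_2)).
Let e2 := lift_dual (k := 3) 4 s basis32 (inverse 3 2 basis32)
  (lift_dual (k := 2) 3 t basis21 (inverse 2 1 basis21) (fun _ : unit => 1 : P 1)).

Definition flagfun : J -> P 5 -> 'F_2 := lift_fun (k := 5) d E2.
Definition flagdual : J -> P 5 := lift_dual (k := 5) 5 d basis53 (inverse 5 3 basis53) e2.

Let d5 : (5 <= d)%N := ltnW d6.

Let lvs r : low_vanish 3 (row_degree 3 N2 r.+1).
Proof. by rewrite /N2 row_degree21E; apply: low_vanish3; apply: leq_trans t4. Qed.

Lemma flag_hitfree p : hitfree n (flagfun p). Proof. exact: lift_hitfree. Qed.

Lemma flag_dual p q : flagfun p (flagdual q) = (p == q)%:R.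
Proof. exact: (lift_dualP cert53 d5 EK Edual). Qed.

Lemma phi_flagdual p : phi (flagdual p) = 0.
Proof. exact: (phi_lift_dual d cert53). Qed.

Lemma flag_span K : hitfree n K -> exists c : J -> 'F_2, forall (I : {set 'I_5}) g,
  (#|I| <= 4)%N -> K (xprod I * g ^+ 2) = \sum_p c p * flagfun p (xprod I * g ^+ 2).
Proof.
move=> HK; apply: (lift_span cert53 isT isT isT isT lvs d5 _ EK Espan HK) => r hr.
(* [d >= 6] gives [r >= 3], the number of rows that [swap5] requires. *)
have -> : r = (r - 3).+3 by lia.
by rewrite /N2 row_degree21E; apply: swap5; apply: leq_trans t4.
Qed.

(** When only the full first row contributes, [K] is [phi] followed by a functional that kills hits
    in degree [m]. *)
Lemma full_krow_hitfree K : hitfree n K ->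
  (forall (I : {set 'I_5}) g, (#|I| <= 4)%N -> K (xprod I * g ^+ 2) = 0) ->
  hitfree m (krow K setT) /\ forall f, K f = krow K setT (phi f).
Proof.
move=> HK h0; have h0' (I : {set 'I_5}) g : I != setT -> K (xprod I * g ^+ 2) = 0.
  move=> nI; apply: h0; rewrite -ltnS.
  have : (#|I| < #|[set: 'I_5]|)%N by rewrite proper_card // properEneq nI subsetT.
  by rewrite cardsT card_ord.
split.
- split=> [f g|f|x hx]; rewrite /krow.
  + by rewrite mp_sqrD mulrDr (KD HK).
  + rewrite (K_xprod_sqr HK) (bigD1 setT) ?subsetT //= setDv big_set0 mul1r.
    by rewrite big1 ?addr0 // => L /andP[_ nL]; apply: h0'.
  + have hT := xprod_homog [set: 'I_5].
    apply: (Khomog HK (dhomogM hT (dhomogMn 2 (mon_homog x)))).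
    by rewrite cardsT card_ord nm muln2 eqn_add2l -!addnn; apply: contra hx => /eqP; lia.
- move=> f; rewrite /krow; elim/mp_split_ind: f => [|I x|f g If Ig].
  + by rewrite phi0 expr0n mulr0 (K0 HK).
  + rewrite phi_monoid; case: eqVneq => [->//|nI].
    by rewrite expr0n mulr0 (K0 HK) h0'.
  + by rewrite phiD mp_sqrD mulrDr !(KD HK) If Ig.
Qed.

Let U := kameko_preim 5 n m.
Let H := hit 5 n.

Lemma toP_kameko (f : HP 5 n) K : hitfree m K -> K (toP (kameko m f)) = K (phi (toP f)).
Proof. by move=> HK; rewrite kameko_fromP // K_fromP. Qed.

Lemma mem_preim (f : HP 5 n) : (f \in U) = (kameko m f \in hit 5 m).
Proof. by rewrite -memv_preim (linfunE (@kameko_linear 5 n m)). Qed.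

Lemma hit_preim : (H <= U)%VS.
Proof.
apply/subvP => f Hf; rewrite mem_preim; apply: hit_separated => K HK.
rewrite toP_kameko //; apply: (K_hit (K := fun p => K (phi p)) _ Hf).
by rewrite nm; apply: phi_hitfree.
Qed.

Definition flag_eval (f : HP 5 n) : {ffun J -> ('F_2)^o} := [ffun p => flagfun p (toP f)].

Lemma flag_eval_linear : linear flag_eval.
Proof.
move=> c f g; apply/ffunP => p; rewrite !ffunE toP_linear (KD (flag_hitfree p)).
by rewrite (KZ (flag_hitfree p)).
Qed.

Let Ev := linfun flag_eval.

(** Modulo flag functionals, a functional that kills hits factors through [phi] and therefore
    vanishes on [U]. So the flag functionals alone detect hits inside [U]. *)
Lemma flag_eval_ker : (U :&: lker Ev)%VS = H.
Proof.
apply/eqP; rewrite eqEsubv; apply/andP; split; last first.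
  rewrite subv_cap hit_preim; apply/subvP => f Hf; rewrite memv_ker.
  rewrite (linfunE flag_eval_linear); apply/eqP/ffunP => p; rewrite !ffunE.
  exact: K_hit (flag_hitfree p) Hf.
apply/subvP => f /memv_capP [fU]; rewrite memv_ker (linfunE flag_eval_linear) => /eqP/ffunP f0.
apply: hit_separated => K HK; have [c Ec] := flag_span HK.
pose K' p := K p + \sum_j c j * flagfun j p.
have HK' : hitfree n K' by apply: hitfreeD => //; apply: hitfree_sum => j; apply: flag_hitfree.
have [HM EM] : hitfree m (krow K' setT) /\ forall f, K' f = krow K' setT (phi f).
  by apply: full_krow_hitfree => // I g hI; rewrite /K' Ec // F2_addxx.
have K'f : K' (toP f) = 0.
  by rewrite EM -toP_kameko //; apply: K_hit HM _; rewrite -mem_preim.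
move: K'f; rewrite /K' [X in _ + X]big1 ?addr0 // => j _.
by have := f0 j; rewrite !ffunE => ->; rewrite mulr0.
Qed.

(** The polynomials [flagdual p] lie in the kernel of [phi] and are dual to the flag functionals. *)
Lemma flag_eval_img : (Ev @: U)%VS = fullv.
Proof.
apply/eqP; rewrite eqEsubv subvf; apply/subvP => g _.
pose f p := fromP n (flagdual p).
have fU p : f p \in U.
  rewrite mem_preim kameko_of_fromP // phi_flagdual.
  suff -> : fromP m 0 = 0 :> HP 5 m by apply: mem0v.
  by apply/ffunP => a; rewrite !ffunE mcoeff0.
have Ef p : Ev (f p) = [ffun q => (q == p)%:R].
  rewrite (linfunE flag_eval_linear); apply/ffunP => q; rewrite !ffunE.
  by rewrite (K_fromP _ (flag_hitfree q)) flag_dual.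
rewrite (ffun_delta g); apply: rpred_sum => p _; apply: rpredZ.
by rewrite -Ef; apply: memv_img.
Qed.

Lemma dim_kernel : (\dim U - \dim H)%N = 3255%N.
Proof.
rewrite -(limg_ker_dim Ev U) flag_eval_ker flag_eval_img addKn dimvf.
transitivity (#|{: J}| * 1)%N; first by [].
by rewrite muln1 !card_prod !card_ord size_pts53 size_pts32 size_pts21 card_unit.
Qed.

End Main.

Theorem theorem1p2 (d s t : nat) :
  (6 <= d)%N -> (4 <= s)%N -> (4 <= t)%N ->
  let n := (2 ^ (d + s + t) + 2 ^ (d + s) + 2 ^ d - 3)%N in
  let m := ((n - 5) %/ 2)%N in
  (hit 5 n <= kameko_preim 5 n m)%VS /\
  (\dim (kameko_preim 5 n m) - \dim (hit 5 n))%N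
    = ((2 ^ 3 - 1) * (2 ^ 4 - 1) * (2 ^ 5 - 1))%N.
Proof.
move=> d6 s4 t4 n m.
(* [n] is the degree of [d] rows of size 3, then [s] of size 2, then [t] of size 1. *)
have En : n = row_degree 3 (row_degree 2 (row_degree 1 0 t) s) d.
  have := row_degree_closed 3 (row_degree 2 (row_degree 1 0 t) s) d.
  rewrite [X in (2 ^ d * (X + 3))%N]row_degree21E.
  have -> : (2 ^ (s + t) + 2 ^ s - 2 + 3 = 2 ^ (s + t) + 2 ^ s + 1)%N.
    by have := expn_gt0 2 s; have := expn_gt0 2 (s + t); lia.
  by rewrite !mulnDr muln1 -!expnD [(d + (s + t))%N]addnA => e; rewrite /n -e addnK.
(* The division in [m] is exact because [n] is odd and at least 5. *)
have nm : n = (5 + m.*2)%N.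
  have : odd n by rewrite En; case: (d) d6 => // d' _; rewrite odd_row_degree.
  have : (5 <= n)%N by rewrite En; case: (d) d6 => [//|[//|d']] _ /=; lia.
  by rewrite /m; lia.
have E : ((2 ^ 3 - 1) * (2 ^ 4 - 1) * (2 ^ 5 - 1))%N = 3255%N by [].
rewrite E; move: (m) nm; rewrite En => m' nm'.
by split; [apply: hit_preim | apply: dim_kernel].
Qed.
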